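(* Let $G=r_{\max}+2R$. The iterates $\theta_1,\dots,\theta_T$ of the MLMC-AdaGrad projected TD algorithm satisfy \[ \mathbb{E}\big[\|V_{\theta^*}-V_{\bar\theta_T}\|_M^2\big]\le\tilde{\mathcal{O}}\Big(\frac{GR\sqrt{\tau_{\mathrm{mix}}}}{(1-\gamma)\sqrt T}\Big),\qquad \bar\theta_T=\frac1T\sum_{t=1}^T\theta_t. \]
   Context: Consider a Markov reward process on a finite state space $\mathcal{S}$ with transition kernel $\mathcal{P}^\pi$, reward function $\mathcal{R}^\pi(s,s')\in[-r_{\max},r_{\max}]$ and discount $\gamma\in[0,1)$; its state chain is ergodic with unique stationary distribution $\mu$. Observed samples are triplets $z=(s,r,s')$ with $r=\mathcal{R}^\pi(s,s')$, $s'\sim\mathcal{P}^\pi(\cdot\mid s)$, forming a Markov chain $(z_k)_{k\ge1}$; $\tau_{\mathrm{mix}}$ is its mixing time: with $\|P-Q\|_{TV}=\sup_A|P(A)-Q(A)|$, $P^s(z,\cdot)$ the law of $z_{s+1}$ given $z_1=z$ and $d_{\mathrm{mix}}(s)=\sup_z\|P^s(z,\cdot)-\nu\|_{TV}$ ($\nu$ the stationary law), $\tau_{\mathrm{mix}}=\inf\{s:d_{\mathrm{mix}}(s)\le1/4\}$. Features $\phi:\mathcal{S}\to\mathbb{R}^d$ satisfy $\|\phi(s)\|\le1$; $V_\theta(s)=\phi(s)^\top\theta$; $M=\mathrm{diag}(\mu(s))_{s\in\mathcal{S}}$ and $\|V\|_M^2=\sum_s\mu(s)V(s)^2$. Semi-gradient: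 $g(\theta;z)=(r+\gamma\phi(s')^\top\theta-\phi(s)^\top\theta)\phi(s)$, and $\bar g(\theta)=\mathbb{E}_{s\sim\mu,\,s'\sim\mathcal{P}^\pi(\cdot|s)}[(\mathcal{R}^\pi(s,s')+\gamma\phi(s')^\top\theta-\phi(s)^\top\theta)\phi(s)]$. $\theta^*$ satisfies $\bar g(\theta^* )=0$, and $R>0$ satisfies $\|\theta^*\|\le R$; $\mathcal{K}=\{\theta:\|\theta\|\le R\}$. Algorithm (inputs $T$, $\theta_1\in\mathcal{K}$): for $t=1,\dots,T$: draw $J_t$ with $\mathbb{P}(J_t=j)=2^{-j}$, $j\ge1$, independently of the chain and previous draws; $N_t=2^{J_t}$; iteration $t$ uses the next $N_t$ samples $z_t^{(i)}=z_{S_{t-1}+i}$, $S_{t-1}=N_1+\dots+N_{t-1}$; $g_t^j=2^{-j}\sum_{i=1}^{2^j}g(\theta_t;z_t^{(i)})$ for $j\ge0$; $g_t=g_t^0+2^{J_t}(g_t^{J_t}-g_t^{J_t-1})$ if $2^{J_t}\le T$, else $g_t=g_t^0$; $\eta_t=\sqrt2R/\sqrt{\sum_{k=1}^t\|g_k\|^2}$; $\theta_{t+1}=\Pi_{\mathcal{K}}(\theta_t+\eta_tg_t)$ (Euclidean projection). The notation $\tilde{\mathcal{O}}(X)$ means a quantity bounded by $c\cdot X$ times a factor polylogarithmic in $T$ and $\tau_{\mathrm{mix}}$, with $c$ an absolute constant. *)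

(* Defs.v *)
From HB Require Import structures.
From mathcomp Require Import all_boot all_order all_algebra.
From mathcomp Require Import all_classical all_reals all_analysis.
Set Implicit Arguments. Unset Strict Implicit. Unset Printing Implicit Defensive.
Import Order.TTheory GRing.Theory Num.Theory.
Local Open Scope ring_scope.

Section Defs.
Variable R : realType.

Definition dotv d (u v : 'rV[R]_d) : R := \sum_(i < d) u 0 i * v 0 i.
Definition normv d (u : 'rV[R]_d) : R := Num.sqrt (dotv u u).

Definition is_ball_proj d (Rad : R) (pr : 'rV[R]_d -> 'rV[R]_d) : Prop :=
  forall x, normv (pr x) <= Rad /\
    forall y, normv y <= Rad -> normv (x - pr x) <= normv (x - y).

Variable S : finType.

Definition stochastic (Pk : S -> S -> R) : Prop :=
  (forall a b, 0 <= Pk a b) /\ (forall a, \sum_b Pk a b = 1).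
Definition is_distr (m : S -> R) : Prop :=
  (forall a, 0 <= m a) /\ \sum_a m a = 1.
Definition stationary (Pk : S -> S -> R) (mu : S -> R) : Prop :=
  is_distr mu /\ (forall b, \sum_a mu a * Pk a b = mu b).
Fixpoint kpow (Pk : S -> S -> R) (n : nat) : S -> S -> R :=
  match n with
  | 0 => fun a b => (a == b)%:R
  | n'.+1 => fun a b => \sum_c kpow Pk n' a c * Pk c b
  end.
(* irreducible + aperiodic (primitive) finite chain *)
Definition ergodic (Pk : S -> S -> R) : Prop :=
  exists m, forall a b, 0 < kpow Pk m a b.

(* The sample chain z_k = (s_k, R(s_k,s_{k+1}), s_{k+1}); since r is a
   deterministic function of (s,s'), it is represented by the pair (s,s'). *)
Definition pairQ (Pk : S -> S -> R) (z w : S * S) : R :=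
  (z.2 == w.1)%:R * Pk w.1 w.2.
Fixpoint pair_law (Pk : S -> S -> R) (n : nat) (z : S * S) : S * S -> R :=
  match n with
  | 0 => fun w => (z == w)%:R
  | n'.+1 => fun w => \sum_u pair_law Pk n' z u * pairQ Pk u w
  end.
Definition pair_stat (Pk : S -> S -> R) (mu : S -> R) (w : S * S) : R :=
  mu w.1 * Pk w.1 w.2.
Definition tv (T : finType) (p q : T -> R) : R :=
  \big[Num.max/0]_(A : {set T}) `| \sum_(x in A) p x - \sum_(x in A) q x |.
Definition dmix (Pk : S -> S -> R) (mu : S -> R) (s : nat) : R :=
  \big[Num.max/0]_(z : S * S) tv (pair_law Pk s z) (pair_stat Pk mu).
Definition is_mixing_time (Pk : S -> S -> R) (mu : S -> R) (tau : nat) : Prop :=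
  (0 < tau)%N /\ dmix Pk mu tau <= 4^-1 /\
  (forall s, (0 < s)%N -> (s < tau)%N -> 4^-1 < dmix Pk mu s).

Variable d : nat.

Definition Vf (phi : S -> 'rV[R]_d) (th : 'rV[R]_d) (s : S) : R := dotv (phi s) th.

Definition gsemi (gam : R) (Rw : S -> S -> R) (phi : S -> 'rV[R]_d)
  (th : 'rV[R]_d) (a b : S) : 'rV[R]_d :=
  (Rw a b + gam * Vf phi th b - Vf phi th a) *: phi a.

Definition gbar (Pk : S -> S -> R) (mu : S -> R) (gam : R) (Rw : S -> S -> R)
  (phi : S -> 'rV[R]_d) (th : 'rV[R]_d) : 'rV[R]_d :=
  \sum_a mu a *: \sum_b Pk a b *: gsemi gam Rw phi th a b.

Definition Mnorm2 (mu : S -> R) (f : S -> R) : R := \sum_a mu a * f a ^+ 2.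

(* ---- The MLMC-AdaGrad projected TD algorithm, as a deterministic function
   of the draws J (J t = J_{t+1}) and the state path (path k = s_{k+1});
   sample number k+1 is z_{k+1} = (path k, R(path k, path k.+1), path k.+1).
   Everything is 0-indexed: iteration t here is iteration t+1 of the paper. *)
Variables (gam : R) (Rw : S -> S -> R) (phi : S -> 'rV[R]_d) (Rad : R)
  (pr : 'rV[R]_d -> 'rV[R]_d) (th1 : 'rV[R]_d) (T : nat)
  (J : nat -> nat) (path : nat -> S).

Definition Ssum (t : nat) : nat := (\sum_(u < t) 2 ^ J u)%N.

Definition gj (t j : nat) (th : 'rV[R]_d) : 'rV[R]_d :=
  ((2%:R : R) ^+ j)^-1 *:
    \sum_(i < 2 ^ j) gsemi gam Rw phi th (path (Ssum t + i)) (path (Ssum t + i).+1).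

Definition gmlmc (t : nat) (th : 'rV[R]_d) : 'rV[R]_d :=
  if (2 ^ J t <= T)%N
  then gj t 0 th + ((2%:R : R) ^+ J t) *: (gj t (J t) th - gj t (J t).-1 th)
  else gj t 0 th.

(* adagrad t = (theta_{t+1}, sum_{k<=t} ||g_k||^2) *)
Fixpoint adagrad (t : nat) : 'rV[R]_d * R :=
  match t with
  | 0 => (th1, 0)
  | t'.+1 =>
      let th := (adagrad t').1 in
      let g := gmlmc t' th in
      let q := (adagrad t').2 + normv g ^+ 2 in
      (pr (th + (Num.sqrt 2 * Rad / Num.sqrt q) *: g), q)
  end.

(* theta t = theta_{t+1} *)
Definition theta (t : nat) : 'rV[R]_d := (adagrad t).1.

Definition thetabar : 'rV[R]_d := (T%:R)^-1 *: \sum_(t < T) theta t.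

End Defs.

Definition geom2 (R : realType) (j : nat) : R :=
  if (0 < j)%N then ((2%:R : R) ^+ j)^-1 else 0.

(* Main.v *)
Require Import Defs.
From HB Require Import structures.
From mathcomp Require Import all_boot all_order all_algebra.
From mathcomp Require Import all_classical all_reals all_analysis.
From mathcomp Require Import measurable_realfun.
From mathcomp Require Import ring lra.
Import Order.TTheory GRing.Theory Num.Theory.
Local Open Scope classical_set_scope.
Local Open Scope ring_scope.

(* The inequality <gbar(theta), thetastar - theta> >= (1 - gamma) |V* - V_theta|_M^2
   reduces the claim, by convexity, to a regret bound.  Pathwise, AdaGrad has regret
   O(Rad sqrt (sum_t |g_t|^2)).  Conditionally on the past, the multilevel estimator has the bias of
   a plain average of about T samples, which is O(G tau / T), and a second moment
   O(G^2 tau log T): a block of N samples started anywhere has centred second moment O(G^2 tau N),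
   since conditional means of centred samples halve every tau steps.
   As X and J are discrete, conditioning on the past means integrating over each of the countably
   many events fixing the draws and the path so far.  For tau > T the bound is trivial. *)

(** * Euclidean norm and projection *)

(** The iterate depends on the very trajectory that the next block continues, and a block starts
    where the previous one stopped, not in stationarity. Fixing the past handles both: on such an
    event the iterate is a constant vector, so the block averages one fixed function of transitions
    with stationary mean zero, and every block estimate is uniform in the starting state.

    The logarithm counts levels. Level j has weight 2^j and probability 2^-j, and the difference of
    its two averages has second moment O(G^2 tau / 2^j); the product 4^j 2^-j 2^-j leaves O(G^2 tau)
    for each of about log2 T levels.

    The square root in the regret is random and correlated with the estimators. It is dominated by
    an affine function of sum |g_t|^2 with deterministic coefficients, tuned to the typical size G
    sqrt(tau T) up to logarithms. Then only a sum of one-iteration expectations has to be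
    bounded. *)

Section Vectors.
Context {R : realType} {d : nat}.
Implicit Types (u v w : 'rV[R]_d) (a : R).

Lemma dotvC u v : dotv u v = dotv v u.
Proof. by apply: eq_bigr => i _; rewrite mulrC. Qed.

Lemma dotvDl u v w : dotv (u + v) w = dotv u w + dotv v w.
Proof. by rewrite -big_split; apply: eq_bigr => i _; rewrite mxE mulrDl. Qed.

Lemma dotvZl a u v : dotv (a *: u) v = a * dotv u v.
Proof. by rewrite mulr_sumr; apply: eq_bigr => i _; rewrite mxE mulrA. Qed.

Lemma dotvNl u v : dotv (- u) v = - dotv u v.
Proof. by rewrite -scaleN1r dotvZl mulN1r. Qed.

Lemma dotvBl u v w : dotv (u - v) w = dotv u w - dotv v w.
Proof. by rewrite dotvDl dotvNl. Qed.

Lemma dotvDr u v w : dotv w (u + v) = dotv w u + dotv w v.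
Proof. by rewrite !(dotvC w) dotvDl. Qed.

Lemma dotvZr a u v : dotv u (a *: v) = a * dotv u v.
Proof. by rewrite !(dotvC u) dotvZl. Qed.

Lemma dotvNr u v : dotv u (- v) = - dotv u v.
Proof. by rewrite !(dotvC u) dotvNl. Qed.

Lemma dotvBr u v w : dotv w (u - v) = dotv w u - dotv w v.
Proof. by rewrite dotvDr dotvNr. Qed.

Lemma dot0v v : dotv 0 v = 0.
Proof. by rewrite -(scale0r 0) dotvZl mul0r. Qed.

Lemma dotv_suml (I : Type) (r : seq I) (p : pred I) (F : I -> 'rV[R]_d) v :
  dotv (\sum_(i <- r | p i) F i) v = \sum_(i <- r | p i) dotv (F i) v.
Proof.
exact: (big_morph (fun u => dotv u v) (fun x y => dotvDl x y v) (dot0v v)).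
Qed.

Lemma dotvv_ge0 u : 0 <= dotv u u.
Proof. by apply: sumr_ge0 => i _; rewrite -expr2 sqr_ge0. Qed.

Lemma normv_ge0 u : 0 <= normv u.
Proof. exact: sqrtr_ge0. Qed.

Lemma normv_sqr u : normv u ^+ 2 = dotv u u.
Proof. by rewrite sqr_sqrtr // dotvv_ge0. Qed.

Lemma normv0 : normv (0 : 'rV[R]_d) = 0.
Proof. by rewrite /normv dot0v sqrtr0. Qed.

Lemma normvZ a u : normv (a *: u) = `|a| * normv u.
Proof.
rewrite /normv dotvZl dotvZr mulrA -expr2 sqrtrM ?sqr_ge0 //.
by rewrite sqrtr_sqr.
Qed.

Lemma normvN u : normv (- u) = normv u.
Proof. by rewrite -scaleN1r normvZ normrN1 mul1r. Qed.

Lemma normvBC u v : normv (u - v) = normv (v - u).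
Proof. by rewrite -normvN opprB. Qed.

Lemma normv_sqrD u v :
  normv (u + v) ^+ 2 = normv u ^+ 2 + 2 * dotv u v + normv v ^+ 2.
Proof. by rewrite !normv_sqr dotvDl !dotvDr (dotvC v u); ring. Qed.

Lemma normv_sqrB u v :
  normv (u - v) ^+ 2 = normv u ^+ 2 - 2 * dotv u v + normv v ^+ 2.
Proof. by rewrite normv_sqrD dotvNr normvN; ring. Qed.

(** Cauchy-Schwarz, from the square of [|v| u - |u| v]. If one norm vanishes that square is
    uninformative; expanding [|u - s v|^2 >= 0] at a well-chosen [s] then contradicts a positive
    inner product. *)
Lemma dotv_le u v : dotv u v <= normv u * normv v.
Proof.
have [v0|v0] := eqVneq (normv v) 0; last first.
  have vp : 0 < normv v by rewrite lt_neqAle eq_sym v0 normv_ge0.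
  have := sqr_ge0 (normv (normv v *: u - normv u *: v)).
  rewrite normv_sqrB !normvZ dotvZl dotvZr !ger0_norm ?normv_ge0 // => H.
  have [u0|u0] := eqVneq (normv u) 0; last first.
    have up : 0 < normv u by rewrite lt_neqAle eq_sym u0 normv_ge0.
    by rewrite -(ler_pM2l (mulr_gt0 up vp)); lra.
  rewrite u0 mul0r.
  have h (s : R) : 0 < s -> 2 * dotv u v <= s * normv v ^+ 2.
    move=> s0; have := sqr_ge0 (normv (u - s *: v)).
    rewrite normv_sqrB normvZ dotvZr u0 exprMn real_normK ?num_real // => k.
    by rewrite -(ler_pM2l s0); lra.
  rewrite leNgt; apply/negP => p.
  have := h (dotv u v / normv v ^+ 2) (divr_gt0 p (exprn_gt0 _ vp)).
  by rewrite mulfVK ?expf_neq0 //; lra.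
rewrite v0 mulr0.
rewrite leNgt; apply/negP => p.
set s := (normv u ^+ 2 + 1) / dotv u v.
have := sqr_ge0 (normv (u - s *: v)).
rewrite normv_sqrB normvZ v0 dotvZr /s mulfVK ?gt_eqF //.
have := sqr_ge0 (normv u); lra.
Qed.

Lemma normr_dotv_le u v : `|dotv u v| <= normv u * normv v.
Proof.
rewrite ler_norml dotv_le andbT lerNl -dotvNl (le_trans (dotv_le _ _)) //.
by rewrite normvN.
Qed.

Lemma normvD u v : normv (u + v) <= normv u + normv v.
Proof.
rewrite -(ler_pXn2r (n := 2)) ?nnegrE ?addr_ge0 ?normv_ge0 //.
rewrite normv_sqrD; have := dotv_le u v; lra.
Qed.

Lemma normvB u v : normv (u - v) <= normv u + normv v.
Proof. by rewrite -(normvN v) normvD. Qed.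

Lemma normv_sqrB_le u v : normv (u - v) ^+ 2 <= 2 * normv u ^+ 2 + 2 * normv v ^+ 2.
Proof.
have := sqr_ge0 (normv (u + v)); rewrite (normv_sqrD u v) normv_sqrB; lra.
Qed.

Lemma normv_sqrD_le u v : normv (u + v) ^+ 2 <= 2 * normv u ^+ 2 + 2 * normv v ^+ 2.
Proof. by have := normv_sqrB_le u (- v); rewrite opprK normvN. Qed.

Lemma normv_sum (I : Type) (r : seq I) (p : pred I) (F : I -> 'rV[R]_d) :
  normv (\sum_(i <- r | p i) F i) <= \sum_(i <- r | p i) normv (F i).
Proof.
elim/big_ind2 : _ => [|u x v y ux vy|//]; first by rewrite normv0.
by rewrite (le_trans (normvD _ _)) // lerD.
Qed.

(* First-order optimality of the projection, tested along segments to [y],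
   gives <x - pr x, y - pr x> <= 0. *)
Lemma ball_proj_contract Rad (pr : 'rV[R]_d -> 'rV[R]_d) x y :
  is_ball_proj Rad pr -> normv y <= Rad -> normv (pr x - y) <= normv (x - y).
Proof.
move=> /(_ x) [pK pmin] yK; set p := pr x in pK pmin *.
have h (s : R) : 0 < s -> s <= 1 ->
    2 * dotv (x - p) (y - p) <= s * normv (y - p) ^+ 2.
  move=> s0 s1; have : normv (p + s *: (y - p)) <= Rad.
    have -> : p + s *: (y - p) = (1 - s) *: p + s *: y.
      by rewrite scalerBr scalerBl scale1r addrA addrAC.
    rewrite (le_trans (normvD _ _)) // !normvZ (gtr0_norm s0) ger0_norm ?subr_ge0 //.
    have := ler_wpM2l (ltW s0) yK; have : 0 <= 1 - s by lra.
    move=> /ler_wpM2l /(_ _ _ pK); lra.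
  move/pmin; rewrite opprD addrA.
  rewrite -(ler_pXn2r (n := 2)) ?nnegrE ?normv_ge0 //.
  rewrite [X in _ <= X]normv_sqrB normvZ dotvZr exprMn real_normK ?num_real // => k.
  by rewrite -(ler_pM2l s0); lra.
have le0 : dotv (x - p) (y - p) <= 0.
  rewrite leNgt; apply/negP => q.
  have h1 := h 1 ltr01 (lexx _); set e := dotv _ _ in q h1 h.
  have N0 : 0 < normv (y - p) ^+ 2 by lra.
  (* This value of [s] is at most 1, since [h 1] gives [2 * e <= |y - p|^2]; it turns [h] into
     [2 * e <= e]. *)
  have := h (e / normv (y - p) ^+ 2) (divr_gt0 q N0).
  rewrite ler_pdivrMr // mul1r mulfVK ?gt_eqF // => /(_ _).
  by have [//|] := leP e (normv (y - p) ^+ 2) => [_ /(_ isT)|]; lra.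
rewrite -(ler_pXn2r (n := 2)) ?nnegrE ?normv_ge0 //.
have -> : x - y = (x - p) - (y - p) by rewrite opprB addrA addrNK.
rewrite (normv_sqrB (x - p)) (normvBC p); have := sqr_ge0 (normv (x - p)); lra.
Qed.

End Vectors.

(** * AdaGrad regret *)

Section Adagrad.
Context {R : realType} {S : finType} {d : nat}.
Variables (gam : R) (Rw : S -> S -> R) (phi : S -> 'rV[R]_d) (Rad : R).
Variables (pr : 'rV[R]_d -> 'rV[R]_d) (th1 : 'rV[R]_d) (T : nat).
Variables (J : nat -> nat) (path : nat -> S).
Hypothesis prP : is_ball_proj Rad pr.
Hypothesis th1K : normv th1 <= Rad.

Local Notation th := (theta gam Rw phi Rad pr th1 T J path).
Local Notation g := (fun t => gmlmc gam Rw phi T J path t (th t)).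

Lemma theta_in_ball t : normv (th t) <= Rad.
Proof. by case: t => [//|t]; exact: (prP _).1. Qed.

Lemma adagrad_sumsq t :
  (adagrad gam Rw phi Rad pr th1 T J path t).2 = \sum_(u < t) normv (g u) ^+ 2.
Proof. by elim: t => [|t IH]; rewrite ?big_ord0 // big_ord_recr /= IH. Qed.

(** One AdaGrad step in scalars: [d0], [d1] are squared distances to the comparator, [s], [s'] the
    roots of the gradient sums, [n] the gradient norm, [c / s'] the step size. Dividing the
    contraction inequality by twice the step size leaves [c n^2 / (2 s')], at most [c (s' - s)]
    because [n^2 = (s' - s)(s' + s)]. The growth of the weight on [d0] costs another [c (s' - s)],
    by the diameter bound [d0 <= 2 c^2]. *)
Lemma regret_step (c s s' n e d0 d1 : R) :
  0 < c -> 0 <= s -> 0 <= s' -> s' ^+ 2 = s ^+ 2 + n ^+ 2 -> `|e| <= n * (2 * c) ->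
  0 <= n -> d0 <= 2 * c ^+ 2 -> d1 <= d0 - 2 * (c / s') * e + (c / s') ^+ 2 * n ^+ 2 ->
  e + d1 * s' / (2 * c) <= d0 * s / (2 * c) + 2 * c * (s' - s).
Proof.
move=> c0 s0 s0' E eB n0 d0B d1B.
(* All gradients so far vanish. The step size is then [c / 0 = 0] and the contraction carries no
   information, but the bound on [|e|] forces [e = 0]. *)
have [z|z] := eqVneq s' 0.
  rewrite z expr0n /= in E.
  have s00 : s = 0 by apply/eqP; rewrite -sqrf_eq0; apply/eqP; have := sqr_ge0 s; have := sqr_ge0 n; lra.
  have n00 : n = 0 by apply/eqP; rewrite -sqrf_eq0; apply/eqP; have := sqr_ge0 s; have := sqr_ge0 n; lra.
  move: eB; rewrite n00 mul0r normr_le0 => /eqP ->.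
  by rewrite z s00 !mulr0 !mul0r subrr mulr0 addr0.
have sp : 0 < s' by rewrite lt_neqAle eq_sym z.
have ss : s <= s'.
  by rewrite -(ler_pXn2r (n := 2)) ?nnegrE // E lerDl sqr_ge0.
have h1 : d1 * s' / (2 * c) <= d0 * s' / (2 * c) - e + c * n ^+ 2 / (2 * s').
  have -> : d0 * s' / (2 * c) - e + c * n ^+ 2 / (2 * s') =
    (d0 - 2 * (c / s') * e + (c / s') ^+ 2 * n ^+ 2) * (s' / (2 * c)).
    by field; rewrite z gt_eqF.
  by rewrite -mulrA ler_wpM2r // divr_ge0 // mulr_ge0 // ltW.
have h2 : d0 * (s' - s) / (2 * c) <= c * (s' - s).
  have -> : c * (s' - s) = (2 * c ^+ 2) * (s' - s) / (2 * c) by field; rewrite gt_eqF.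
  by rewrite ler_wpM2r ?invr_ge0 ?ler_wpM2r ?subr_ge0 // mulr_ge0 // ltW.
have h3 : c * n ^+ 2 / (2 * s') <= c * (s' - s).
  rewrite ler_pdivrMr ?mulr_gt0 // -mulrA; apply: (ler_wpM2l (ltW c0)).
  have -> : n ^+ 2 = (s' - s) * (s' + s) by rewrite -subr_sqr E; ring.
  by rewrite ler_wpM2l ?subr_ge0 //; lra.
have -> : d0 * s / (2 * c) = d0 * s' / (2 * c) - d0 * (s' - s) / (2 * c).
  by field; rewrite gt_eqF.
lra.
Qed.

(** The squared distance, weighted by the inverse of twice the latest step size, is kept on the left
    as a potential: without it the telescoping sum would not close under induction. *)
Lemma adagrad_regret_potential (thstar : 'rV[R]_d) t : 0 < Rad -> normv thstar <= Rad ->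
  \sum_(u < t) dotv (g u) (thstar - th u) +
    normv (th t - thstar) ^+ 2 *
      Num.sqrt (\sum_(u < t) normv (g u) ^+ 2) / (2 * (Num.sqrt 2 * Rad)) <=
  2 * (Num.sqrt 2 * Rad) * Num.sqrt (\sum_(u < t) normv (g u) ^+ 2).
Proof.
move=> R0 sK; set c := Num.sqrt 2 * Rad.
have c0 : 0 < c by rewrite mulr_gt0 ?sqrtr_gt0.
have c2 : c ^+ 2 = 2 * Rad ^+ 2 by rewrite exprMn sqr_sqrtr.
elim: t => [|t IH]; first by rewrite !big_ord0 sqrtr0 !(mulr0, mul0r, addr0).
rewrite !big_ord_recr /=.
set A := \sum_(u < t) dotv _ _ in IH *; set Q := \sum_(u < t) _ ^+ 2 in IH *.
have Q0 : 0 <= Q by apply: sumr_ge0 => u _; exact: sqr_ge0.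
have Q1 : 0 <= Q + normv (g t) ^+ 2 by rewrite addr_ge0 ?sqr_ge0.
have D (u : 'rV[R]_d) : normv u <= Rad -> normv (u - thstar) <= 2 * Rad.
  by move=> uK; rewrite (le_trans (normvB _ _)) //; lra.
have h := @regret_step c (Num.sqrt Q) (Num.sqrt (Q + normv (g t) ^+ 2)) (normv (g t))
  (dotv (g t) (thstar - th t)) (normv (th t - thstar) ^+ 2)
  (normv (th t.+1 - thstar) ^+ 2) c0 (sqrtr_ge0 _) (sqrtr_ge0 _).
rewrite (sqr_sqrtr Q0) (sqr_sqrtr Q1) in h; have {}h := h erefl.
suff: [/\ `|dotv (g t) (thstar - th t)| <= normv (g t) * (2 * c),
    normv (th t - thstar) ^+ 2 <= 2 * c ^+ 2 &
    normv (th t.+1 - thstar) ^+ 2 <= normv (th t - thstar) ^+ 2 -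
     2 * (c / Num.sqrt (Q + normv (g t) ^+ 2)) * dotv (g t) (thstar - th t) +
     (c / Num.sqrt (Q + normv (g t) ^+ 2)) ^+ 2 * normv (g t) ^+ 2].
  by move=> [a b e]; have := h a (normv_ge0 _) b e; lra.
clear h; split.
- rewrite (le_trans (normr_dotv_le _ _)) // ler_wpM2l ?normv_ge0 // normvBC.
  have s2 : 1 <= Num.sqrt 2 :> R by rewrite -[X in X <= _]sqrtr1 ler_sqrt ?ler1n.
  rewrite (le_trans (D _ (theta_in_ball t))) //; apply: ler_wpM2l => //.
  exact: ler_peMl (ltW R0) s2.
- rewrite c2; have := D _ (theta_in_ball t) => h.
  have : normv (th t - thstar) ^+ 2 <= (2 * Rad) ^+ 2 by rewrite ler_pXn2r ?nnegrE ?normv_ge0 //; lra.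
  by rewrite exprMn; lra.
- set e := c / _.
  have -> : th t.+1 = pr (th t + e *: g t) by rewrite {1}/theta /= adagrad_sumsq.
  have le := ball_proj_contract _ _ (th t + e *: g t) _ prP sK.
  have : normv (pr (th t + e *: g t) - thstar) ^+ 2 <=
         normv (th t + e *: g t - thstar) ^+ 2 by rewrite ler_pXn2r ?nnegrE ?normv_ge0.
  have -> : th t + e *: g t - thstar = (th t - thstar) + e *: g t by rewrite addrAC.
  move=> /le_trans; apply; rewrite normv_sqrD normvZ exprMn real_normK ?num_real //.
  by rewrite dotvZr -(opprB (th t)) dotvNr (dotvC (g t)); lra.
Qed.

Lemma adagrad_regret (thstar : 'rV[R]_d) t : 0 < Rad -> normv thstar <= Rad ->
  \sum_(u < t) dotv (g u) (thstar - th u) <=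
  2 * (Num.sqrt 2 * Rad) * Num.sqrt (\sum_(u < t) normv (g u) ^+ 2).
Proof.
move=> R0 sK; apply: le_trans (adagrad_regret_potential thstar t R0 sK).
rewrite lerDl divr_ge0 ?mulr_ge0 ?sqrtr_ge0 ?normv_ge0 ?exprn_ge0 //.
exact: ltW.
Qed.

(** The bound on [i] is inclusive because the last transition of the block ends in state number
    [Ssum J t.+1], which is also the first state of the next block. *)
Lemma gmlmc_ext (J' : nat -> nat) (path' : nat -> S) t x :
  (forall u, (u < t.+1)%N -> J u = J' u) ->
  (forall i, (i <= Ssum J t.+1)%N -> path i = path' i) ->
  gmlmc gam Rw phi T J path t x = gmlmc gam Rw phi T J' path' t x.
Proof.
move=> hJ hp.
have eS : Ssum J t = Ssum J' t by apply: eq_bigr => u _; rewrite hJ // ltnS ltnW.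
have gjE j : (j <= J t)%N -> gj gam Rw phi J path t j x = gj gam Rw phi J' path' t j x.
  move=> jJ; rewrite /gj -eS; congr (_ *: _); apply: eq_bigr => i _.
  have h : ((Ssum J t + i).+1 <= Ssum J t.+1)%N.
    rewrite /Ssum big_ord_recr /= -addnS leq_add2l (leq_trans (ltn_ord i)) //.
    by rewrite leq_pexp2l.
  by rewrite !hp // ltnW.
by rewrite /gmlmc -(hJ t) // !gjE // leq_pred.
Qed.

Lemma adagrad_ext (J' : nat -> nat) (path' : nat -> S) t :
  (forall u, (u < t)%N -> J u = J' u) ->
  (forall i, (i <= Ssum J t)%N -> path i = path' i) ->
  adagrad gam Rw phi Rad pr th1 T J path t = adagrad gam Rw phi Rad pr th1 T J' path' t.
Proof.
elim: t => [//|t IH] hJ hp /=.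
have lS : (Ssum J t <= Ssum J t.+1)%N by rewrite /Ssum big_ord_recr leq_addr.
rewrite -(gmlmc_ext _ _ _ _ hJ hp) -IH // => [u ut|i it]; first by rewrite hJ // ltnS ltnW.
by rewrite hp // (leq_trans it).
Qed.

End Adagrad.

(** * Mean semi-gradient *)

Section TemporalDifference.
Context {R : realType} {S : finType} {d : nat}.
Variables (Pk : S -> S -> R) (mu : S -> R) (gam : R) (Rw : S -> S -> R).
Variables (phi : S -> 'rV[R]_d) (rmax Rad : R).
Hypothesis stoch : stochastic Pk.
Hypothesis stat : stationary Pk mu.
Hypothesis Rw_le : forall a b, `|Rw a b| <= rmax.
Hypothesis gam0 : 0 <= gam.
Hypothesis gam1 : gam < 1.
Hypothesis phi_le : forall s, normv (phi s) <= 1.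

Lemma normr_Vf_le th s : `|Vf phi th s| <= normv th.
Proof.
rewrite (le_trans (normr_dotv_le _ _)) // -[leRHS]mul1r.
by rewrite ler_wpM2r ?normv_ge0.
Qed.

Lemma normv_gsemi_le th a b : normv th <= Rad ->
  normv (gsemi gam Rw phi th a b) <= rmax + 2 * Rad.
Proof.
move=> thK; rewrite normvZ.
have h : `|Rw a b + gam * Vf phi th b - Vf phi th a| <= rmax + 2 * Rad.
  rewrite (le_trans (ler_normB _ _)) // (le_trans (lerD (ler_normD _ _) (lexx _))) //.
  rewrite normrM (ger0_norm gam0).
  have := normr_Vf_le th a; have := Rw_le a b.
  have : gam * `|Vf phi th b| <= `|Vf phi th b| by rewrite ler_piMl // ltW.
  have := normr_Vf_le th b; lra.
rewrite (le_trans _ h) // ler_piMr //.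
Qed.

Lemma normv_mean_le (B : R) (p : S -> R) (F : S -> 'rV[R]_d) : is_distr p ->
  (forall a, normv (F a) <= B) -> normv (\sum_a p a *: F a) <= B.
Proof.
move=> [p0 p1] FB; rewrite (le_trans (normv_sum _ _ _ _)) //.
rewrite -[leRHS]mul1r -p1 mulr_suml; apply: ler_sum => a _.
by rewrite normvZ ger0_norm // ler_wpM2l.
Qed.

Lemma stochastic_distr a : is_distr (Pk a).
Proof. by split => [b|]; [exact: stoch.1|exact: stoch.2]. Qed.

Lemma normv_gbar_le th : normv th <= Rad ->
  normv (gbar Pk mu gam Rw phi th) <= rmax + 2 * Rad.
Proof.
move=> thK; apply: normv_mean_le stat.1 _ => a.
apply: normv_mean_le (stochastic_distr a) _ => b.
exact: normv_gsemi_le.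
Qed.

(** Subtracting [gbar thstar = 0] removes the rewards and leaves the stationary mean of
    [(D a - gam * D b) * D a]. By stationarity [D a] and [D b] have the same second moment, and
    [D a * D b] is at most half the sum of the two squares. *)
Lemma gbar_dot_ge th thstar : gbar Pk mu gam Rw phi thstar = 0 ->
  (1 - gam) * Mnorm2 mu (fun s => Vf phi thstar s - Vf phi th s) <=
  dotv (gbar Pk mu gam Rw phi th) (thstar - th).
Proof.
move=> gs0; pose D s := Vf phi thstar s - Vf phi th s.
have -> : dotv (gbar Pk mu gam Rw phi th) (thstar - th) =
    \sum_a \sum_b mu a * Pk a b * ((D a - gam * D b) * D a).
  rewrite -[gbar _ _ _ _ _ th]subr0 -gs0 /gbar -sumrB dotv_suml.
  apply: eq_bigr => a _; rewrite -scalerBr -sumrB dotvZl dotv_suml mulr_sumr.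
  apply: eq_bigr => b _; rewrite -scalerBr dotvZl mulrA; congr (_ * _).
  rewrite /gsemi -scalerBl dotvZl dotvBr /D /Vf; ring.
have mean_l : \sum_a \sum_b mu a * Pk a b * D a ^+ 2 = Mnorm2 mu D.
  apply: eq_bigr => a _; rewrite -mulr_suml -mulr_sumr stoch.2 mulr1 //.
have mean_r : \sum_a \sum_b mu a * Pk a b * D b ^+ 2 = Mnorm2 mu D.
  by rewrite exchange_big; apply: eq_bigr => b _; rewrite -mulr_suml stat.2.
have -> : (1 - gam) * Mnorm2 mu D = \sum_a \sum_b mu a * Pk a b *
    (D a ^+ 2 - gam / 2 * (D a ^+ 2 + D b ^+ 2)).
  have -> : (1 - gam) * Mnorm2 mu D = (1 - gam / 2) * Mnorm2 mu D - gam / 2 * Mnorm2 mu D.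
    by field.
  rewrite -{1}mean_l -mean_r !mulr_sumr -sumrB; apply: eq_bigr => a _.
  rewrite !mulr_sumr -sumrB; apply: eq_bigr => b _; ring.
apply: ler_sum => a _; apply: ler_sum => b _.
apply: ler_wpM2l; first by rewrite mulr_ge0 ?stat.1.1 ?stoch.1.
have : 0 <= gam / 2 * (D a - D b) ^+ 2 by rewrite mulr_ge0 ?divr_ge0 ?sqr_ge0.
lra.
Qed.

Lemma sqr_mean_le (T : nat) (x : nat -> R) : (0 < T)%N ->
  (T%:R^-1 * \sum_(t < T) x t) ^+ 2 <= T%:R^-1 * \sum_(t < T) x t ^+ 2.
Proof.
move=> T0; have n0 : T%:R != 0 :> R by rewrite pnatr_eq0 -lt0n.
set m := _ * _; rewrite -subr_ge0.
have : 0 <= T%:R^-1 * \sum_(t < T) (x t - m) ^+ 2.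
  by rewrite mulr_ge0 ?invr_ge0 // sumr_ge0 // => t _; exact: sqr_ge0.
suff -> : \sum_(t < T) (x t - m) ^+ 2 = \sum_(t < T) x t ^+ 2 - T%:R * m ^+ 2.
  by rewrite mulrBr mulrA mulVf // mul1r.
have -> : T%:R * m ^+ 2 = 2 * m * (\sum_(t < T) x t) - \sum_(t < T) m ^+ 2.
  rewrite sumr_const card_ord -mulr_natl.
  have -> : \sum_(t < T) x t = T%:R * m by rewrite /m mulrA mulfV // mul1r.
  ring.
rewrite mulr_sumr opprB addrA -big_split -sumrB; apply: eq_bigr => t _ /=; ring.
Qed.

Lemma Mnorm2_mean_le (th : nat -> 'rV[R]_d) thstar (T : nat) : (0 < T)%N ->
  Mnorm2 mu (fun s => Vf phi thstar s - Vf phi (T%:R^-1 *: \sum_(t < T) th t) s) <=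
  T%:R^-1 * \sum_(t < T) Mnorm2 mu (fun s => Vf phi thstar s - Vf phi (th t) s).
Proof.
move=> T0; have n0 : T%:R != 0 :> R by rewrite pnatr_eq0 -lt0n.
rewrite exchange_big mulr_sumr; apply: ler_sum => a _.
rewrite -[in leRHS]mulr_sumr [leRHS]mulrCA; apply: ler_wpM2l; first exact: stat.1.1.
apply: le_trans (sqr_mean_le T (fun t => Vf phi thstar a - Vf phi (th t) a) T0); rewrite le_eqVlt; apply/orP; left; apply/eqP; congr (_ ^+ 2).
rewrite sumrB sumr_const card_ord -(mulr_natl (Vf phi thstar a)) mulrBr mulrA mulVf // mul1r; congr (_ - _).
by rewrite {1}/Vf dotvZr dotvC dotv_suml; congr (_ * _); apply: eq_bigr => t _; rewrite dotvC.
Qed.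

Lemma Mnorm2_le thstar th : normv thstar <= Rad -> normv th <= Rad ->
  Mnorm2 mu (fun s => Vf phi thstar s - Vf phi th s) <= (2 * Rad) ^+ 2.
Proof.
move=> h1 h2; rewrite -[leRHS]mul1r -[X in _ <= X * _]stat.1.2 mulr_suml.
apply: ler_sum => a _; apply: ler_wpM2l; first exact: stat.1.1.
rewrite -real_normK ?num_real // ler_pXn2r ?nnegrE //; last first.
  by have := normv_ge0 th; lra.
rewrite (le_trans (ler_normB _ _)) //.
have := normr_Vf_le th a; have := normr_Vf_le thstar a; lra.
Qed.

End TemporalDifference.

(** * Mixing *)

(** The positive part of [p - q] lives on a set and the negative part on its complement; each costs
    one [tv]. *)
Lemma l1_le_tv {R : realType} (T : finType) (p q : T -> R) :
  \sum_x `|p x - q x| <= 2 * tv p q.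
Proof.
have tvA (A : {set T}) : `|\sum_(x in A) p x - \sum_(x in A) q x| <= tv p q.
  exact: le_bigmax.
pose A : {set T} := [set x | q x <= p x]%SET.
rewrite (bigID (mem A)) /= mulr_natl mulr2n; apply: lerD.
  apply: le_trans (tvA A); rewrite -sumrB (eq_bigr (fun x => p x - q x)) ?ler_norm //.
  by move=> x; rewrite inE => h; rewrite ger0_norm // subr_ge0.
apply: le_trans (tvA (~: A)%SET); rewrite distrC -sumrB (eq_bigl (mem (~: A)%SET)); last first.
  by move=> x; rewrite !inE.
rewrite (eq_bigr (fun x => q x - p x)) ?ler_norm //.
move=> x; rewrite !inE -ltNge => h; rewrite distrC ger0_norm // subr_ge0 ltW //.
Qed.

(** Each power of 1/2 occurs at most [tau] times. The first [tau] terms give at most [tau], and the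
    rest is half of a shorter sum of the same shape. *)
Lemma sum_half_divn_le {R : realType} (tau N : nat) : (0 < tau)%N ->
  \sum_(m < N) (2^-1 : R) ^+ (m %/ tau) <= 2 * tau%:R.
Proof.
move=> t0; elim/ltn_ind: N => N IH.
have le1 (k : nat) : \sum_(m < k) (2^-1 : R) ^+ (m %/ tau) <= k%:R.
  rewrite -[k in leRHS]card_ord -sum1_card natr_sum; apply: ler_sum => i _.
  by rewrite exprn_ile1 ?invr_ge0 // invf_le1 ?ler1n.
have [le|lt] := leqP N tau.
  apply: le_trans (le1 N) _.
  have : N%:R <= tau%:R :> R by rewrite ler_nat.
  have : 0 <= tau%:R :> R by []; lra.
rewrite -(subnKC (ltnW lt)) big_split_ord /=.
have -> : \sum_(i < N - tau) (2^-1 : R) ^+ ((tau + i) %/ tau) =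
   2^-1 * \sum_(i < N - tau) (2^-1 : R) ^+ (i %/ tau).
  rewrite mulr_sumr; apply: eq_bigr => i _.
  by rewrite divnDl // divnn t0 add1n exprS.
have := le1 tau; have := IH (N - tau)%N; rewrite ltn_subrL t0 (leq_trans _ lt) // => /(_ isT).
set a := \sum_(i < N - tau) _; set b := \sum_(i < tau) _.
lra.
Qed.

Section Mixing.
Context {R : realType} {S : finType} {d : nat}.
Variables (Pk : S -> S -> R) (mu : S -> R) (tau : nat).
Hypothesis stoch : stochastic Pk.
Hypothesis stat : stationary Pk mu.
Hypothesis mix : is_mixing_time Pk mu tau.

Lemma pair_law_kpow n a b c e : pair_law Pk n.+1 (a, b) (c, e) = kpow Pk n b c * Pk c e.
Proof.
elim: n c e => [|n IH] c e.
  rewrite /= (bigD1 (a, b)) //= eqxx mul1r /pairQ big1 ?addr0 // => u ub.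
  by rewrite eq_sym (negbTE ub) mul0r.
transitivity (\sum_u pair_law Pk n.+1 (a, b) u * pairQ Pk u (c, e)); first by [].
rewrite -(pair_bigA _ (fun x y => pair_law Pk n.+1 (a, b) (x, y) * pairQ Pk (x, y) (c, e))).
rewrite [kpow _ _ _ _]/= mulr_suml; apply: eq_bigr => x _.
rewrite (eq_bigr (fun y => kpow Pk n b x * Pk x y * ((y == c)%:R * Pk c e))); last first.
  by move=> y _; rewrite IH.
rewrite (bigD1 c) //= eqxx mul1r big1 ?addr0 // => y yc.
by rewrite (negbTE yc) mul0r mulr0.
Qed.

Variables (F : S -> S -> 'rV[R]_d) (B : R).
Hypothesis FB : forall a b, normv (F a b) <= B.
Hypothesis F0 : \sum_a mu a *: \sum_b Pk a b *: F a b = 0.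

(* [shifted_mean m x] is E[F(X_m, X_{m+1}) | X_0 = x]. *)
Fixpoint shifted_mean (m : nat) (x : S) : 'rV[R]_d :=
  if m is m'.+1 then \sum_y Pk x y *: shifted_mean m' y else \sum_y Pk x y *: F x y.

Lemma normv_shifted_mean_le m x : normv (shifted_mean m x) <= B.
Proof.
elim: m x => [|m IH] x /=; apply: normv_mean_le (stochastic_distr _ stoch x) _ => y //.
Qed.

Lemma stat_shifted_mean m : \sum_x mu x *: shifted_mean m x = 0.
Proof.
elim: m => [//|m IH] /=; rewrite -[RHS]IH.
under eq_bigr do rewrite scaler_sumr.
rewrite exchange_big; apply: eq_bigr => y _ /=.
rewrite -[in RHS]stat.2 scaler_suml; apply: eq_bigr => x _; by rewrite scalerA.
Qed.

Lemma shifted_meanD n m x :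
  shifted_mean (n + m) x = \sum_y kpow Pk n x y *: shifted_mean m y.
Proof.
elim: n m => [|n IH] m.
  rewrite (bigD1 x) //= eqxx scale1r big1 ?addr0 // => y yx.
  by rewrite eq_sym (negbTE yx) scale0r.
rewrite addSnnS IH /=.
under eq_bigr do rewrite scaler_sumr.
rewrite exchange_big; apply: eq_bigr => y _ /=.
by rewrite scaler_suml; apply: eq_bigr => z _; rewrite scalerA.
Qed.

(* As stationary means vanish, the law after [tau] steps may be replaced by its
   difference with the stationary law, whose l1 norm is at most 1/2. *)
Lemma shifted_mean_contract m (C : R) x : (forall y, normv (shifted_mean m y) <= C) ->
  normv (shifted_mean (tau + m) x) <= 2^-1 * C.
Proof.
case: mix => t0 [mix4 _] hC; case: tau t0 mix4 => [//|t] _ mix4.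
(* After at least one step the pair law depends only on the second component of its start, so
   [(x, x)] can stand for the state [x]; this is where [tau > 0] enters. *)
have -> : shifted_mean (t.+1 + m) x = \sum_w
    (pair_law Pk t.+1 (x, x) w - pair_stat Pk mu w) *: shifted_mean m w.2.
  under eq_bigr do rewrite scalerBl.
  rewrite sumrB (_ : \sum_w pair_stat Pk mu w *: _ = 0) ?subr0; last first.
    rewrite -[RHS](stat_shifted_mean m).
    rewrite -(pair_bigA _ (fun y z => pair_stat Pk mu (y, z) *: shifted_mean m z)) /=.
    rewrite exchange_big; apply: eq_bigr => y _ /=.
    by rewrite -scaler_suml -[in RHS]stat.2.
  rewrite -(pair_bigA _ (fun y z => pair_law Pk t.+1 (x, x) (y, z) *: shifted_mean m z)).
  rewrite shifted_meanD exchange_big; apply: eq_bigr => y _.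
  by rewrite [kpow _ _ _ _]/= scaler_suml; apply: eq_bigr => z _; rewrite pair_law_kpow.
have C0 : 0 <= C by apply: le_trans (hC x); exact: normv_ge0.
have h : \sum_w `|pair_law Pk t.+1 (x, x) w - pair_stat Pk mu w| <= 2^-1.
  apply: le_trans (l1_le_tv _ _ _) _.
  have : tv (pair_law Pk t.+1 (x, x)) (pair_stat Pk mu) <= 4^-1.
    apply: le_trans mix4.
    exact: (le_bigmax _ (fun z => tv (pair_law Pk t.+1 z) (pair_stat Pk mu))).
  lra.
apply: le_trans (ler_wpM2r C0 h).
rewrite mulr_suml (le_trans (normv_sum _ _ _ _)) //; apply: ler_sum => w _.
by rewrite normvZ ler_wpM2l.
Qed.

Lemma normv_shifted_mean_mix m x : normv (shifted_mean m x) <= B * 2^-1 ^+ (m %/ tau).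
Proof.
have t0 : (0 < tau)%N by case: mix.
rewrite {1}(divn_eq m tau); elim: (m %/ tau)%N x => [|k IH] x.
  by rewrite mulr1 normv_shifted_mean_le.
by rewrite mulSn -addnA exprS mulrCA; exact: shifted_mean_contract.
Qed.

(** Geometric decay makes the total mean of a block bounded independently of its length. This serves
    twice: for the bias of averages and for the cross terms in their second moments. *)
Lemma sum_shifted_mean_le N x : normv (\sum_(m < N) shifted_mean m x) <= 2 * B * tau%:R.
Proof.
have B0 : 0 <= B by apply: le_trans (FB x x); exact: normv_ge0.
rewrite (le_trans (normv_sum _ _ _ _)) // mulrAC mulrC.
apply: le_trans (ler_wpM2l B0 (sum_half_divn_le _ N (proj1 mix))).
by rewrite mulr_sumr; apply: ler_sum => i _; exact: normv_shifted_mean_mix.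
Qed.

End Mixing.

(** * Expectation of bounded functions *)

Section BoundedExpectation.
Context {R : realType} {dm : measure_display} {Omega : measurableType dm}.
Variable P : probability Omega R.
Implicit Types f g : Omega -> R.

(** This class is closed under sums and products and integrable under any probability, so linearity
    and monotonicity of [expect] need no further integrability argument. *)
Definition bmeas f := measurable_fun setT f /\ exists K, forall w, `|f w| <= K.

Definition expect f : R := Rintegral P setT f.

Lemma bmeas_integrable f : bmeas f -> P.-integrable setT (EFin \o f).
Proof.
move=> [mf [K fK]]; apply: measurable_bounded_integrable => //.
  by rewrite (le_lt_trans (probability_le1 _ _)) // ltry.
exists K; split; first exact: num_real.
by move=> x Kx w _; apply: (le_trans (fK w)); exact: ltW.
Qed.

Lemma bmeas_cst (c : R) : bmeas (fun=> c).
Proof. by split; [exact: measurable_cst|exists `|c|]. Qed.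

Lemma bmeasD f g : bmeas f -> bmeas g -> bmeas (fun w => f w + g w).
Proof.
move=> [mf [K fK]] [mg [L gL]]; split; first exact: measurable_funD.
by exists (K + L) => w; rewrite (le_trans (ler_normD _ _)) // lerD.
Qed.

Lemma bmeasM f g : bmeas f -> bmeas g -> bmeas (fun w => f w * g w).
Proof.
move=> [mf [K fK]] [mg [L gL]]; split; first exact: measurable_funM.
by exists (K * L) => w; rewrite normrM ler_pM.
Qed.

Lemma bmeasZ (c : R) f : bmeas f -> bmeas (fun w => c * f w).
Proof. by move=> bf; apply: bmeasM => //; exact: bmeas_cst. Qed.

Lemma bmeas_sum (I : Type) (r : seq I) (F : I -> Omega -> R) :
  (forall i, bmeas (F i)) -> bmeas (fun w => \sum_(i <- r) F i w).
Proof.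
move=> bF; elim: r => [|i r IH].
  by under eq_fun do rewrite big_nil; exact: bmeas_cst.
by under eq_fun do rewrite big_cons; exact: bmeasD.
Qed.

Lemma bmeas_prod (I : Type) (r : seq I) (F : I -> Omega -> R) :
  (forall i, bmeas (F i)) -> bmeas (fun w => \prod_(i <- r) F i w).
Proof.
move=> bF; elim: r => [|i r IH].
  by under eq_fun do rewrite big_nil; exact: bmeas_cst.
by under eq_fun do rewrite big_cons; exact: bmeasM.
Qed.

Lemma bmeas_bool (b : Omega -> bool) : measurable [set w | b w] ->
  bmeas (fun w => (b w)%:R).
Proof.
move=> mb; have -> : (fun w => (b w)%:R) = \1_[set w | b w] :> (Omega -> R).
  by apply/funext => w; rewrite indicE; congr (nat_of_bool _)%:R; apply/idP/idP; rewrite inE.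
split; first exact: measurable_indic.
by exists 1 => w; rewrite indicE ger0_norm // lern1 leq_b1.
Qed.

Lemma expectD f g : bmeas f -> bmeas g ->
  expect (fun w => f w + g w) = expect f + expect g.
Proof. by move=> bf bg; apply: RintegralD => //; exact: bmeas_integrable. Qed.

Lemma expectZ (c : R) f : bmeas f -> expect (fun w => c * f w) = c * expect f.
Proof. by move=> bf; apply: RintegralZl => //; exact: bmeas_integrable. Qed.

Lemma expect_cst (c : R) : expect (fun=> c) = c.
Proof.
rewrite /expect Rintegral_cst // -[RHS]mulr1; congr (_ * _).
by rewrite -[LHS]/(fine (P [set: Omega])) probability_setT.
Qed.

Lemma expect_le f g : bmeas f -> bmeas g -> (forall w, f w <= g w) ->
  expect f <= expect g.
Proof. by move=> bf bg fg; apply: le_Rintegral => //; exact: bmeas_integrable. Qed.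

Lemma expect_ge0 f : (forall w, 0 <= f w) -> 0 <= expect f.
Proof. by move=> f0; apply: Rintegral_ge0. Qed.

Lemma expect_sum (I : Type) (r : seq I) (F : I -> Omega -> R) :
  (forall i, bmeas (F i)) ->
  expect (fun w => \sum_(i <- r) F i w) = \sum_(i <- r) expect (F i).
Proof.
move=> bF; elim: r => [|i r IH].
  rewrite big_nil -[RHS]expect_cst; congr expect; apply/funext => w.
  by rewrite big_nil.
rewrite big_cons -IH -expectD //; last exact: bmeas_sum.
by congr expect; apply/funext => w; rewrite big_cons.
Qed.

Lemma expect_bool (b : Omega -> bool) : measurable [set w | b w] ->
  expect (fun w => (b w)%:R) = fine (P [set w | b w]).
Proof.
move=> mb; rewrite /expect /Rintegral; congr fine.
rewrite -[RHS]mul1e -[RHS](integral_cst P mb 1) [RHS]integral_mkcond.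
apply: eq_integral => w _; rewrite patchE.
have -> : (w \in [set w | b w]) = b w by apply/idP/idP; rewrite inE.
by case: (b w).
Qed.

(** Countable additivity over the level sets of [h]: for [f >= 0] the integral is the limit of the
    finite partial sums. *)
Lemma expect_partition_le (h : Omega -> nat) f (c : R) :
  (forall k, measurable [set w | h w = k]) -> bmeas f -> (forall w, 0 <= f w) ->
  (forall N, \sum_(k < N) expect (fun w => f w * (h w == k)%:R) <= c) ->
  expect f <= c.
Proof.
move=> mh bf f0 fc; rewrite -lee_fin /expect /Rintegral fineK; last first.
  exact: integrable_fin_num (bmeas_integrable _ bf).
have bfk k : bmeas (fun w => f w * (h w == k)%:R).
  apply: bmeasM => //; apply: bmeas_bool.
  by rewrite (_ : [set _ | _] = [set w | h w = k]) //; apply/seteqP; split => w /eqP.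
have -> : setT = \bigcup_k [set w | h w = k] by apply/seteqP; split => // w _; exists (h w).
rewrite ge0_integral_bigcup //=; last 3 first.
- have -> : \bigcup_k [set w | h w = k] = setT by apply/seteqP; split => // w _; exists (h w).
  by apply/measurable_EFinP; case: bf.
- by move=> w _; rewrite lee_fin.
- by move=> i j _ _ [w [/= <- <-]].
have E k : (\int[P]_(w in [set w | h w = k]) (f w)%:E)%E =
    (expect (fun w => f w * (h w == k)%:R))%:E.
  rewrite /expect /Rintegral fineK; last first.
    exact: integrable_fin_num (bmeas_integrable _ (bfk k)).
  rewrite [LHS]integral_mkcond; apply: eq_integral => w _; rewrite patchE.
  case: ifPn => [|]; first by rewrite inE /= => ->; rewrite eqxx mulr1.
  by rewrite notin_setE /= => /eqP/negbTE ->; rewrite mulr0.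
apply: lime_le.
  by apply: is_cvg_nneseries => k _ _; rewrite E lee_fin expect_ge0 // => w; rewrite mulr_ge0.
apply: nearW => N; under eq_bigr do rewrite E.
by rewrite big_mkord sumEFin lee_fin.
Qed.

(** Every preimage is a countable union of level sets of [h]. This is how quantities built from the
    projection [pr] become measurable. *)
Lemma bmeas_countable (h : Omega -> nat) f :
  (forall k, measurable [set w | h w = k]) ->
  (forall w w', h w = h w' -> f w = f w') -> (exists K, forall w, `|f w| <= K) ->
  bmeas f.
Proof.
move=> mh hf; split => // _ B mB; rewrite setTI.
have -> : f @^-1` B = \bigcup_(k in [set k | exists w, h w = k /\ B (f w)]) [set w | h w = k].
  apply/seteqP; split => [w Bw|w [k [w' [hk Bw']] /= hw]].
    by exists (h w) => //; exists w.
  by rewrite /preimage /= (hf w w') // hw.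
by apply: bigcup_measurable => k _.
Qed.

Lemma bmeas_normv_sqr d (Z : Omega -> 'rV[R]_d) :
  (forall k, bmeas (fun w => Z w 0 k)) -> bmeas (fun w => normv (Z w) ^+ 2).
Proof.
move=> bZ; under eq_fun do rewrite normv_sqr.
by apply: bmeas_sum => k; exact: bmeasM.
Qed.

End BoundedExpectation.

(** * The chain and the draws *)

Set Implicit Arguments.

Section ChainAndDraws.
Context {R : realType} {S : finType} {dm : measure_display} {Omega : measurableType dm}.
Variables (P : probability Omega R) (Pk : S -> S -> R) (T : nat).
Variables (X : nat -> Omega -> S) (J : nat -> Omega -> nat).
Hypothesis stoch : stochastic Pk.
Hypothesis mX : forall k a, measurable [set w | X k w = a].
Hypothesis mJ : forall t j, measurable [set w | J t w = j].
Hypothesis law : forall (n : nat) (a : nat -> S) (js : nat -> nat),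
  P [set w | (forall i, (i <= n)%N -> X i w = a i) /\
             (forall t, (t < T)%N -> J t w = js t)]
  = (P [set w | X 0%N w = a 0%N] *
     ((\prod_(i < n) Pk (a i) (a i.+1)) * \prod_(t < T) geom2 R (js t))%:E)%E.

Local Notation E := (expect P).

(** A real product of indicators rather than an event, so that fixing one more state or draw is
    multiplication by one more factor. *)
Definition hist (n m : nat) (a : nat -> S) (js : nat -> nat) (w : Omega) : R :=
  (\prod_(i < n.+1) (X i w == a i)%:R) * \prod_(u < m) (J u w == js u)%:R.

Lemma bmeas_X k a : bmeas (fun w => (X k w == a)%:R : R).
Proof.
apply: bmeas_bool; rewrite (_ : [set _ | _] = [set w | X k w = a]) //.
by apply/seteqP; split => w /eqP.
Qed.

Lemma bmeas_J t j : bmeas (fun w => (J t w == j)%:R : R).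
Proof.
apply: bmeas_bool; rewrite (_ : [set _ | _] = [set w | J t w = j]) //.
by apply/seteqP; split => w /eqP.
Qed.

Lemma bmeas_hist n m a js : bmeas (hist n m a js).
Proof.
by apply: bmeasM; apply: bmeas_prod => i; [exact: bmeas_X|exact: bmeas_J].
Qed.

Lemma hist_ge0 n m a js w : 0 <= hist n m a js w.
Proof. by rewrite mulr_ge0 // prodr_ge0. Qed.

Lemma prod_natr_bool (n : nat) (b : nat -> bool) :
  \prod_(i < n) (b i)%:R = [forall i : 'I_n, b i]%:R :> R.
Proof.
case: forallP => [h|nh].
  by rewrite big1 // => i _; rewrite h.
have [i /negbTE bi] : exists i : 'I_n, ~~ b i.
  by apply/existsP; rewrite -negb_forall; apply/negP => /forallP.
by rewrite (bigD1 i) //= bi mul0r.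
Qed.

Lemma histE n m a js w :
  hist n m a js w = ([forall i : 'I_n.+1, X i w == a i] && [forall u : 'I_m, J u w == js u])%:R.
Proof.
by rewrite /hist (prod_natr_bool _ (fun i => X i w == a i))
  (prod_natr_bool _ (fun u => J u w == js u)) -natrM mulnb.
Qed.

Lemma hist_eq1 n m a js w : hist n m a js w = 1 <->
  (forall i, (i <= n)%N -> X i w = a i) /\ (forall u, (u < m)%N -> J u w = js u).
Proof.
rewrite histE; split.
  case: andP => [[/forallP hX /forallP hJ] _|_ /eqP]; last by rewrite eq_sym oner_eq0.
  split => [i ni|u um]; first by apply/eqP; exact: (hX (Ordinal (ni : (i < n.+1)%N))).
  by apply/eqP; exact: (hJ (Ordinal um)).
move=> [hX hJ]; rewrite (_ : _ && _ = true) //; apply/andP; split.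
  by apply/forallP => i; rewrite hX // -ltnS.
by apply/forallP => u; rewrite hJ.
Qed.

Lemma hist_neq1 n m a js w : hist n m a js w <> 1 -> hist n m a js w = 0.
Proof. by rewrite histE; case: (_ && _). Qed.

Lemma hist_X n m a js b w :
  hist n m a js w * (X n.+1 w == b)%:R = hist n.+1 m (fun i => if i == n.+1 then b else a i) js w.
Proof.
rewrite /hist [in RHS]big_ord_recr /= eqxx mulrAC; congr (_ * _ * _).
by apply: eq_bigr => i _; rewrite (ltn_eqF (ltn_ord i)).
Qed.

Lemma hist_J n m a js j w :
  hist n m a js w * (J m w == j)%:R = hist n m.+1 a (fun u => if u == m then j else js u) w.
Proof.
rewrite /hist [X in _ = _ * X]big_ord_recr /= eqxx -mulrA; congr (_ * (_ * _)).
by apply: eq_bigr => i _; rewrite (ltn_eqF (ltn_ord i)).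
Qed.

Lemma sum_geom2 N : \sum_(j < N.+1) geom2 R j = 1 - 2^-1 ^+ N.
Proof.
elim: N => [|N IH]; first by rewrite big_ord_recr big_ord0 /geom2 /= addr0 subrr.
rewrite big_ord_recr IH /= /geom2 /= -exprVn exprS; lra.
Qed.

Lemma geom2_ge0 j : 0 <= geom2 R j.
Proof. by rewrite /geom2; case: ifP => // _; rewrite invr_ge0 exprn_ge0. Qed.

(** The assumed law fixes all [T] draws at once, so draws are summed out one at a time, by
    descending induction on [m]. Countable additivity gives the upper bound; finite partial sums
    give [c * (1 - 2^-N)] as a lower bound for every [N]. *)
Lemma expect_hist n m a js : (m <= T)%N -> E (hist n m a js) =
  fine (P [set w | X 0%N w = a 0%N]) *
  (\prod_(i < n) Pk (a i) (a i.+1) * \prod_(u < m) geom2 R (js u)).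
Proof.
move=> mT; rewrite -(subKn mT); elim: (T - m)%N {mT} (leq_subr m T) js => [|k IH] kT js.
  rewrite subn0 (_ : hist _ _ _ _ = fun w => ([forall i : 'I_n.+1, X i w == a i] &&
    [forall u : 'I_T, J u w == js u])%:R); last by apply/funext => w; rewrite histE.
  have eS : [set w | [forall i : 'I_n.+1, X i w == a i] && [forall u : 'I_T, J u w == js u]] =
     [set w | (forall i, (i <= n)%N -> X i w = a i) /\ (forall t, (t < T)%N -> J t w = js t)].
    apply/seteqP; split => w /=.
      by move=> h; apply/hist_eq1; rewrite histE h.
    by move/hist_eq1; rewrite histE; case: (_ && _) => // /eqP; rewrite eq_sym oner_eq0.
  rewrite expect_bool; last first.
    have -> : [set w | [forall i : 'I_n.+1, X i w == a i] && [forall u : 'I_T, J u w == js u]] =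
      hist n T a js @^-1` [set 1].
      apply/seteqP; split => w /=; rewrite histE; first by move=> ->.
      by case: (_ && _) => // /eqP; rewrite eq_sym oner_eq0.
    by rewrite -[X in measurable X]setTI; apply: (bmeas_hist n T a js).1.
  rewrite eS law fineM //; first exact: fin_num_measure.
clear m; set m := (T - k.+1)%N; have mk : (T - k)%N = m.+1 by rewrite /m subnSK.
pose c := fine (P [set w | X 0%N w = a 0%N]) *
  (\prod_(i < n) Pk (a i) (a i.+1) * \prod_(u < m) geom2 R (js u)).
have Ej j : E (fun w => hist n m a js w * (J m w == j)%:R) = c * geom2 R j.
  rewrite (_ : (fun w => _) = hist n m.+1 a (fun u => if u == m then j else js u)); last first.
    by apply/funext => w; rewrite hist_J.
  rewrite -mk IH ?(ltnW kT) // mk big_ord_recr /= eqxx /c -!mulrA.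
  by do 3 congr (_ * _); apply: eq_bigr => i _; rewrite (ltn_eqF (ltn_ord i)).
have c0 : 0 <= c.
  rewrite mulr_ge0 ?fine_ge0 ?mulr_ge0 ?prodr_ge0 // => i _; first exact: stoch.1.
  exact: geom2_ge0.
have SN N : \sum_(j < N.+1) E (fun w => hist n m a js w * (J m w == j)%:R) = c * (1 - 2^-1 ^+ N).
  by under eq_bigr do rewrite Ej; rewrite -mulr_sumr sum_geom2.
apply/eqP; rewrite eq_le; apply/andP; split.
  apply: (expect_partition_le P (J m)) => //.
  - exact: bmeas_hist.
  - exact: hist_ge0.
  case=> [|N]; first by rewrite big_ord0.
  by rewrite SN -[leRHS]mulr1 ler_wpM2l // gerBl exprn_ge0 // invr_ge0.
rewrite -/c.
have lb N : c * (1 - 2^-1 ^+ N) <= E (hist n m a js).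
  rewrite -SN -expect_sum; last by move=> j; apply: bmeasM; [exact: bmeas_hist|exact: bmeas_J].
  apply: expect_le; last 1 first.
  - move=> w; rewrite -mulr_sumr -[leRHS]mulr1 ler_wpM2l ?hist_ge0 //.
    have [lt|ge] := ltnP (J m w) N.+1.
      rewrite (bigD1 (Ordinal lt)) //= eqxx big1 ?addr0 // => i; rewrite -val_eqE /=.
      by rewrite eq_sym => /negbTE ->.
    by rewrite big1 // => i _; rewrite gtn_eqF // (leq_trans (ltn_ord i)).
  - by apply: bmeas_sum => j; apply: bmeasM; [exact: bmeas_hist|exact: bmeas_J].
  - exact: bmeas_hist.
rewrite leNgt; apply/negP => lt.
have pos : 0 < c - E (hist n m a js) by rewrite subr_gt0.
(* Since [N <= 2^N], such an [N] makes [c / 2^N] smaller than the supposed gap, against [lb N]. *)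
have [N hN] : exists N : nat, c / (c - E (hist n m a js)) < N%:R.
  by exists (Num.trunc (c / (c - E (hist n m a js)))).+1; exact: truncnS_gt.
have := lb N; rewrite leNgt => /negP; apply.
rewrite mulrBr mulr1 ltrBrDl -ltrBrDr exprVn ltr_pdivrMr ?exprn_gt0 //.
rewrite ltr_pdivrMr // in hN; apply: (lt_le_trans hN).
rewrite mulrC; apply: (ler_wpM2l (ltW pos)).
by rewrite -natrX ler_nat ltnW // ltn_expl.
Qed.

(* [past m n x chi]: [chi] is the indicator of a possible past up to time [n] of
   the chain and up to the [m]-th draw, along which the chain sits at [x]. *)
Definition past (m n : nat) (x : S) (chi : Omega -> R) : Prop :=
  exists a js, [/\ (m <= T)%N, a n = x & chi = hist n m a js].

Lemma past_bmeas m n x chi : past m n x chi -> bmeas chi.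
Proof. by move=> [a [js [_ _ ->]]]; exact: bmeas_hist. Qed.

Lemma past_ge0 m n x chi w : past m n x chi -> 0 <= chi w.
Proof. by move=> [a [js [_ _ ->]]]; exact: hist_ge0. Qed.

Lemma past_expect_ge0 m n x chi : past m n x chi -> 0 <= E chi.
Proof. by move=> h; apply: expect_ge0 => w; exact: past_ge0 h. Qed.

Lemma past_case m n x chi w : past m n x chi -> chi w = 0 \/ X n w = x.
Proof.
move=> [a [js [_ ax ->]]]; have [h|h] := eqVneq (hist n m a js w) 1.
  by right; move/hist_eq1: h => [-> //].
by left; apply/hist_neq1/eqP.
Qed.

(** The Markov property: lengthening the path by one state multiplies the formula of [expect_hist]
    by one transition probability, which depends on the past only through [x]. *)
Lemma past_next m n x chi b : past m n x chi ->
  past m n.+1 b (fun w => chi w * (X n.+1 w == b)%:R) /\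
  E (fun w => chi w * (X n.+1 w == b)%:R) = Pk x b * E chi.
Proof.
move=> [a [js [mT ax ->]]]; pose a' i := if i == n.+1 then b else a i.
have -> : (fun w => hist n m a js w * (X n.+1 w == b)%:R) = hist n.+1 m a' js.
  by apply/funext => w; rewrite hist_X.
split; first by exists a', js; rewrite {1}/a' eqxx.
rewrite !expect_hist // big_ord_recr /= /a' eqxx (ltn_eqF (ltnSn n)) ax /=.
rewrite (eq_bigr (fun i : 'I_n => Pk (a i) (a i.+1))); first by ring.
by move=> i _; rewrite eqSS !ltn_eqF // ltnS ltnW.
Qed.

(** Independence of the draw from the chain. As [n] does not move, the result is again a past at
    [x], so block estimates still apply after the level has been fixed. *)
Lemma past_draw m n x chi j : past m n x chi -> (m < T)%N ->
  past m.+1 n x (fun w => chi w * (J m w == j)%:R) /\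
  E (fun w => chi w * (J m w == j)%:R) = geom2 R j * E chi.
Proof.
move=> [a [js [_ ax ->]]] mT; pose js' u := if u == m then j else js u.
have -> : (fun w => hist n m a js w * (J m w == j)%:R) = hist n m.+1 a js'.
  by apply/funext => w; rewrite hist_J.
split; first by exists a, js'.
rewrite !expect_hist ?(ltnW mT) // big_ord_recr /= /js' eqxx.
rewrite (eq_bigr (fun u : 'I_m => geom2 R (js u))); first by ring.
by move=> i _; rewrite (ltn_eqF (ltn_ord i)).
Qed.

Lemma past_split m n x chi f : past m n x chi -> bmeas f ->
  E (fun w => chi w * f w) = \sum_b E (fun w => chi w * (X n.+1 w == b)%:R * f w).
Proof.
move=> h bf; rewrite -expect_sum; last first.
  by move=> b; apply: bmeasM => //; exact: past_bmeas (past_next b h).1.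
congr expect; apply/funext => w; rewrite (bigD1 (X n.+1 w)) //= eqxx mulr1 big1 ?addr0 //.
by move=> b; rewrite eq_sym => /negbTE ->; rewrite mulr0 mul0r.
Qed.

Lemma bmeas_pair k l (f : S -> S -> R) : bmeas (fun w => f (X k w) (X l w)).
Proof.
rewrite (_ : (fun w => _) = fun w => \sum_a \sum_b f a b * ((X k w == a)%:R * (X l w == b)%:R)).
  by do 2 apply: bmeas_sum => ?; apply: bmeasZ; apply: bmeasM; exact: bmeas_X.
apply/funext => w; rewrite (bigD1 (X k w)) //= (bigD1 (X l w)) //= !eqxx !mulr1.
rewrite !big1 ?addr0 // => [a ha|b hb].
  by rewrite big1 // => b _; rewrite eq_sym (negbTE ha) mul0r mulr0.
by rewrite [in X in _ * (_ * X)]eq_sym (negbTE hb) !mulr0.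
Qed.

(** * Blocks of consecutive samples *)

Section Blocks.
Context {d : nat}.
Variables (mu : S -> R) (tau : nat) (F : S -> S -> 'rV[R]_d) (B : R).
Hypothesis stat : stationary Pk mu.
Hypothesis mix : is_mixing_time Pk mu tau.
Hypothesis FB : forall a b, normv (F a b) <= B.
Hypothesis F0 : \sum_a mu a *: \sum_b Pk a b *: F a b = 0.

Definition block (N n : nat) (w : Omega) : 'rV[R]_d :=
  \sum_(i < N) F (X (n + i)%N w) (X (n + i).+1 w).

Lemma blockS N n w : block N.+1 n w = F (X n w) (X n.+1 w) + block N n.+1 w.
Proof.
rewrite /block big_ord_recl /= addn0; congr (_ + _).
by apply: eq_bigr => i _; rewrite /bump /= add1n addnS addSn.
Qed.

Lemma bmeas_dotv_block N n v : bmeas (fun w => dotv (block N n w) v).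
Proof.
under eq_fun do rewrite dotv_suml.
apply: bmeas_sum => i; exact: (bmeas_pair _ _ (fun a b => dotv (F a b) v)).
Qed.

Lemma bmeas_block N n k : bmeas (fun w => block N n w 0 k).
Proof.
under eq_fun do rewrite summxE.
by apply: bmeas_sum => i; exact: (bmeas_pair _ _ (fun a b => F a b 0 k)).
Qed.

Lemma bmeas_block_sqr N n : bmeas (fun w => normv (block N n w) ^+ 2).
Proof. by apply: bmeas_normv_sqr => k; exact: bmeas_block. Qed.

Lemma past_expect_sample m n x chi i v : past m n x chi ->
  E (fun w => chi w * dotv (F (X (n + i)%N w) (X (n + i).+1 w)) v) =
  dotv (shifted_mean Pk F i x) v * E chi.
Proof.
elim: i n x chi => [|i IH] n x chi h.
  have bf k l : bmeas (fun w => dotv (F (X k w) (X l w)) v).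
    exact: (bmeas_pair _ _ (fun a b => dotv (F a b) v)).
  rewrite addn0 (past_split h (bf _ _)) dotv_suml mulr_suml; apply: eq_bigr => b _.
  have [hb Eb] := past_next b h.
  rewrite dotvZl mulrAC -Eb mulrC -expectZ; last exact: past_bmeas hb.
  congr expect; apply/funext => w.
  have [->|->] := past_case w h; first by rewrite !(mul0r, mulr0).
  have [->|_] := eqVneq (X n.+1 w) b; first by rewrite mulr1 mulrC.
  by rewrite !(mul0r, mulr0).
have bf : bmeas (fun w => dotv (F (X (n + i.+1)%N w) (X (n + i.+1).+1 w)) v).
  exact: (bmeas_pair _ _ (fun a b => dotv (F a b) v)).
rewrite (past_split h bf) [shifted_mean _ _ _ _]/= dotv_suml mulr_suml.
apply: eq_bigr => b _; have [hb Eb] := past_next b h.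
by rewrite addnS -addSn (IH _ _ _ hb) Eb dotvZl; ring.
Qed.

Lemma past_expect_block m n x chi N v : past m n x chi ->
  E (fun w => chi w * dotv (block N n w) v) =
  dotv (\sum_(i < N) shifted_mean Pk F i x) v * E chi.
Proof.
move=> h; rewrite dotv_suml mulr_suml.
under [RHS]eq_bigr do rewrite -(past_expect_sample _ _ h).
rewrite -expect_sum; last first.
  move=> i; apply: bmeasM; first exact: past_bmeas h.
  exact: (bmeas_pair _ _ (fun a b => dotv (F a b) v)).
by congr expect; apply/funext => w; rewrite dotv_suml mulr_sumr.
Qed.

(* Peeling off the first sample, the cross term is a conditional mean of the
   remaining block, which the mixing bound controls uniformly in its length. *)
Lemma past_expect_block_sqr m n x chi N : past m n x chi ->
  E (fun w => chi w * normv (block N n w) ^+ 2) <= N%:R * (5 * B ^+ 2 * tau%:R) * E chi.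
Proof.
have B0 : 0 <= B by apply: le_trans (FB x x); exact: normv_ge0.
have tau1 : 1 <= tau%:R :> R by rewrite ler1n; case: mix.
elim: N n x chi => [|N IH] n x chi h.
  rewrite (_ : (fun w => _) = fun=> 0) ?expect_cst ?mul0r //.
  by apply/funext => w; rewrite /block big_ord0 normv0 expr0n mulr0.
rewrite (past_split h (bmeas_block_sqr _ _)).
rewrite -[E chi]mul1r -[X in _ <= _ * (X * _)](stoch.2 x) mulr_suml mulr_sumr; apply: ler_sum => b _.
have [hb Eb] := past_next b h; have hb0 := past_expect_ge0 hb.
rewrite -Eb; set chi' := (fun w => chi w * (X n.+1 w == b)%:R) in hb Eb hb0 *.
have bchi := past_bmeas hb.
(* Where [chi'] is nonzero the first sample is the constant [F x b], so the cross term is linear in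
   the remaining block. *)
have -> : (fun w => chi w * (X n.+1 w == b)%:R * normv (block N.+1 n w) ^+ 2) = fun w =>
    (normv (F x b) ^+ 2 * chi' w + 2 * (chi' w * dotv (block N n.+1 w) (F x b))) +
    chi' w * normv (block N n.+1 w) ^+ 2.
  apply/funext => w; rewrite -/(chi' w); have [z|xb] := past_case w hb; first by rewrite z; ring.
  have [z|xx] := past_case w h; first by rewrite /chi' z; ring.
  by rewrite blockS xb xx normv_sqrD (dotvC (F x b)); ring.
have b1 : bmeas (fun w => chi' w * dotv (block N n.+1 w) (F x b)).
  by apply: bmeasM => //; exact: bmeas_dotv_block.
have b2 : bmeas (fun w => chi' w * normv (block N n.+1 w) ^+ 2).
  by apply: bmeasM => //; exact: bmeas_block_sqr.
rewrite expectD //; last by apply: bmeasD; exact: bmeasZ.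
rewrite expectD ?expectZ //; [|exact: bmeasZ|exact: bmeasZ].
have i1 : normv (F x b) ^+ 2 * E chi' <= B ^+ 2 * E chi'.
  by rewrite ler_wpM2r // ler_pXn2r ?nnegrE ?normv_ge0.
have i2 : E (fun w => chi' w * dotv (block N n.+1 w) (F x b)) <= 2 * B ^+ 2 * tau%:R * E chi'.
  rewrite (past_expect_block _ _ hb) ler_wpM2r //.
  apply: le_trans (dotv_le _ _) _.
  have -> : 2 * B ^+ 2 * tau%:R = (2 * B * tau%:R) * B by ring.
  by apply: ler_pM; rewrite ?normv_ge0 // (sum_shifted_mean_le _ _ _ stoch stat mix).
have i3 := IH _ _ _ hb.
(* Origin of the constant 5: each peeled sample costs [B^2] for its square and [4 B^2 tau] for the
   cross term, merged by [tau >= 1]. *)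
have i4 : B ^+ 2 * E chi' <= B ^+ 2 * E chi' * tau%:R.
  by rewrite ler_peMr // mulr_ge0 ?exprn_ge0.
rewrite -natr1; lra.
Qed.

Definition avg (j n : nat) (w : Omega) : 'rV[R]_d := ((2%:R : R) ^+ j)^-1 *: block (2 ^ j) n w.

(** The random level enters only through indicators, so every summand has a deterministic weight and
    block length and expectation acts term by term. At most one summand is nonzero. *)
Definition correction (t n jmax : nat) (w : Omega) : 'rV[R]_d :=
  \sum_(j < jmax) ((J t w == j.+1)%:R * 2%:R ^+ j.+1) *: (avg j.+1 n w - avg j n w).

Lemma bmeas_dotv_avg j n v : bmeas (fun w => dotv (avg j n w) v).
Proof. by under eq_fun do rewrite dotvZl; apply: bmeasZ; exact: bmeas_dotv_block. Qed.

Lemma avg_sqr j n w : normv (avg j n w) ^+ 2 =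
  ((2%:R : R) ^+ j)^-1 ^+ 2 * normv (block (2 ^ j) n w) ^+ 2.
Proof. by rewrite normvZ exprMn real_normK ?num_real. Qed.

Lemma bmeas_avg j n k : bmeas (fun w => avg j n w 0 k).
Proof. by under eq_fun do rewrite mxE; apply: bmeasZ; exact: bmeas_block. Qed.

Lemma bmeas_avg_sqr j n : bmeas (fun w => normv (avg j n w) ^+ 2).
Proof. by apply: bmeas_normv_sqr => k; exact: bmeas_avg. Qed.

Lemma bmeas_correction t n jmax k : bmeas (fun w => correction t n jmax w 0 k).
Proof.
under eq_fun do rewrite summxE.
apply: bmeas_sum => j; rewrite (_ : (fun w => _) = fun w =>
    2 ^+ j.+1 * (J t w == j.+1)%:R * (avg j.+1 n w 0 k + (-1) * avg j n w 0 k)).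
  apply: bmeasM; first by apply: bmeasZ; exact: bmeas_J.
  by apply: bmeasD; [|apply: bmeasZ]; exact: bmeas_avg.
by apply/funext => w; rewrite !mxE; ring.
Qed.

Definition mean_avg (j : nat) (x : S) : 'rV[R]_d :=
  ((2%:R : R) ^+ j)^-1 *: \sum_(i < 2 ^ j) shifted_mean Pk F i x.

Lemma normv_mean_avg_le j x : normv (mean_avg j x) <= 2 * B * tau%:R / 2 ^+ j.
Proof.
rewrite normvZ ger0_norm ?invr_ge0 ?exprn_ge0 // mulrC ler_wpM2r ?invr_ge0 ?exprn_ge0 //.
exact: sum_shifted_mean_le stoch stat mix _ _ FB F0 _ _.
Qed.

Lemma past_expect_avg m n x chi j v : past m n x chi ->
  E (fun w => chi w * dotv (avg j n w) v) = dotv (mean_avg j x) v * E chi.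
Proof.
move=> h; rewrite dotvZl -mulrA -(past_expect_block _ _ h) -expectZ; last first.
  by apply: bmeasM; [exact: past_bmeas h|exact: bmeas_dotv_block].
by congr expect; apply/funext => w; rewrite dotvZl mulrCA.
Qed.

Lemma past_expect_avg_sqr m n x chi j : past m n x chi ->
  E (fun w => chi w * normv (avg j n w) ^+ 2) <= 5 * B ^+ 2 * tau%:R / 2 ^+ j * E chi.
Proof.
move=> h; have p0 : 0 < 2 ^+ j :> R by rewrite exprn_gt0.
rewrite (_ : (fun w => _) = fun w => ((2%:R : R) ^+ j)^-1 ^+ 2 *
    (chi w * normv (block (2 ^ j) n w) ^+ 2)); last first.
  by apply/funext => w; rewrite avg_sqr mulrCA.
rewrite expectZ; last by apply: bmeasM; [exact: past_bmeas h|exact: bmeas_block_sqr].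
apply: le_trans (ler_wpM2l (exprn_ge0 2 _) (past_expect_block_sqr (2 ^ j) h)) _.
  by rewrite invr_ge0 ltW.
by rewrite natrX le_eqVlt; apply/orP; left; apply/eqP; field; rewrite gt_eqF.
Qed.

(* The weight [2^j] of the correction at level [j] cancels the probability
   [2^-j] of that level, so the corrections telescope. *)
Lemma past_expect_mlmc t n x chi jmax v : past t n x chi -> (t < T)%N ->
  E (fun w => chi w * dotv (avg 0 n w + correction t n jmax w) v) =
  dotv (mean_avg jmax x) v * E chi.
Proof.
move=> h tT; have bchi := past_bmeas h.
suff [//] : E (fun w => chi w * dotv (avg 0 n w + correction t n jmax w) v) =
  dotv (mean_avg jmax x) v * E chi /\
  bmeas (fun w => chi w * dotv (avg 0 n w + correction t n jmax w) v).
elim: jmax => [|j [IH1 IH2]].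
  rewrite -(past_expect_avg 0 v h); split.
    by congr expect; apply/funext => w; rewrite /correction big_ord0 addr0.
  rewrite (_ : (fun w => _) = fun w => chi w * dotv (avg 0 n w) v).
    by apply: bmeasM => //; exact: bmeas_dotv_avg.
  by apply/funext => w; rewrite /correction big_ord0 addr0.
have [hj Ej] := past_draw j.+1 h tT.
set chi' := (fun w => chi w * (J t w == j.+1)%:R) in hj Ej.
have bj k : bmeas (fun w => chi' w * dotv (avg k n w) v).
  by apply: bmeasM; [exact: past_bmeas hj|exact: bmeas_dotv_avg].
have -> : (fun w => chi w * dotv (avg 0 n w + correction t n j.+1 w) v) = fun w =>
    chi w * dotv (avg 0 n w + correction t n j w) v +
    (2 ^+ j.+1 * (chi' w * dotv (avg j.+1 n w) v) +
     (- 2 ^+ j.+1) * (chi' w * dotv (avg j n w) v)).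
  apply/funext => w; rewrite /correction big_ord_recr /= addrA (dotvDl (_ + _)).
  by rewrite dotvZl dotvBl /chi'; ring.
have b2 : bmeas (fun w => 2 ^+ j.+1 * (chi' w * dotv (avg j.+1 n w) v) +
    (- 2 ^+ j.+1) * (chi' w * dotv (avg j n w) v)).
  by apply: bmeasD; apply: bmeasZ.
split; last exact: bmeasD.
rewrite expectD // IH1 expectD ?expectZ //; [|exact: bmeasZ|exact: bmeasZ].
rewrite !(past_expect_avg _ _ hj) Ej /geom2 /=.
by field; rewrite expf_neq0.
Qed.

Lemma correction_sqr_le t n jmax w : normv (correction t n jmax w) ^+ 2 <=
  \sum_(j < jmax) (J t w == j.+1)%:R * ((2 ^+ j.+1) ^+ 2 *
    (2 * normv (avg j.+1 n w) ^+ 2 + 2 * normv (avg j n w) ^+ 2)).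
Proof.
have term0 j : 0 <= (J t w == j.+1)%:R * (((2 : R) ^+ j.+1) ^+ 2 *
    (2 * normv (avg j.+1 n w) ^+ 2 + 2 * normv (avg j n w) ^+ 2)).
  by rewrite !mulr_ge0 ?addr_ge0 ?mulr_ge0 ?exprn_ge0 ?normv_ge0.
have [/existsP [j /eqP ej]|none] := boolP [exists j : 'I_jmax, J t w == j.+1]; last first.
  rewrite /correction big1 => [|j _].
    by rewrite normv0 expr0n sumr_ge0.
  have /negbTE -> : J t w != j.+1.
    by apply/negP => e; move/negP: none; apply; apply/existsP; exists j.
  by rewrite mul0r scale0r.
have other (k : 'I_jmax) : k != j -> (J t w == k.+1) = false.
  by move=> kj; rewrite ej eqSS eq_sym; exact: negbTE.
rewrite /correction (bigD1 j) //= big1 ?addr0 => [|k /other ->]; last by rewrite mul0r scale0r.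
rewrite (bigD1 j) //= (_ : (J t w == j.+1) = true) ?mul1r; last by rewrite ej eqxx.
rewrite -[leLHS]addr0; apply: lerD; last by apply: sumr_ge0 => k _; exact: term0.
rewrite normvZ exprMn real_normK ?num_real // ler_wpM2l ?exprn_ge0 //.
exact: normv_sqrB_le.
Qed.

(** Each level contributes the same amount. With [p = 2^j]: squared weight [4 p^2], probability
    [1 / (2 p)], and [2 * 5 B^2 tau * (1 / (2 p) + 1 / p)] from the two averages, in total
    [30 B^2 tau]. *)
Lemma past_expect_correction_sqr t n x chi jmax : past t n x chi -> (t < T)%N ->
  E (fun w => chi w * normv (correction t n jmax w) ^+ 2) <=
  jmax%:R * (30 * B ^+ 2 * tau%:R) * E chi.
Proof.
move=> h tT; have bchi := past_bmeas h.
pose f (j : nat) w := chi w * (J t w == j.+1)%:R * normv (avg j.+1 n w) ^+ 2.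
pose g (j : nat) w := chi w * (J t w == j.+1)%:R * normv (avg j n w) ^+ 2.
have bfg j : bmeas (f j) /\ bmeas (g j).
  by split; (apply: bmeasM; [exact: past_bmeas (past_draw j.+1 h tT).1|exact: bmeas_avg_sqr]).
have bfg2 j : bmeas (fun w => 2 * (2 ^+ j.+1) ^+ 2 * f j w + 2 * (2 ^+ j.+1) ^+ 2 * g j w).
  by apply: bmeasD; apply: bmeasZ; case: (bfg j).
apply: (@le_trans _ _ (E (fun w => \sum_(j < jmax)
    (2 * (2 ^+ j.+1) ^+ 2 * f j w + 2 * (2 ^+ j.+1) ^+ 2 * g j w)))).
  apply: expect_le.
  - by apply: bmeasM => //; apply: bmeas_normv_sqr => k; exact: bmeas_correction.
  - by apply: bmeas_sum => j.
  move=> w; apply: le_trans (ler_wpM2l (past_ge0 w h) (correction_sqr_le _ _ _ _)) _.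
  by rewrite mulr_sumr; apply: ler_sum => j _; rewrite /f /g le_eqVlt; apply/orP; left; apply/eqP; ring.
rewrite expect_sum // -[jmax in leRHS]card_ord -sum1_card natr_sum !mulr_suml.
apply: ler_sum => j _; have [hj Ej] := past_draw j.+1 h tT.
have [bf bg] := bfg j.
rewrite expectD ?expectZ //; [|exact: bmeasZ|exact: bmeasZ].
have := past_expect_avg_sqr j.+1 hj; have := past_expect_avg_sqr j hj.
rewrite -/(f j) -/(g j) Ej /geom2 /= (exprS _ j).
set C := 5 * B ^+ 2 * tau%:R; set p := 2 ^+ j; set e := E chi => hg hf.
have p0 : 0 < p by rewrite exprn_gt0.
have P0 : 0 <= 2 * (2 * p) ^+ 2 by rewrite mulr_ge0 ?sqr_ge0.
apply: le_trans (lerD (ler_wpM2l P0 hf) (ler_wpM2l P0 hg)) _.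
rewrite le_eqVlt; apply/orP; left; apply/eqP; rewrite /C; field; rewrite gt_eqF //.
Qed.

End Blocks.

(** * Conditioning on the history *)

Unset Strict Implicit.

Section History.
Context {d : nat}.
Variables (mu : S -> R) (tau : nat) (gam : R) (Rw : S -> S -> R) (phi : S -> 'rV[R]_d).
Variables (rmax Rad : R) (pr : 'rV[R]_d -> 'rV[R]_d) (th1 thstar : 'rV[R]_d).
Hypothesis stat : stationary Pk mu.
Hypothesis mix : is_mixing_time Pk mu tau.
Hypothesis Rw_le : forall a b, `|Rw a b| <= rmax.
Hypothesis gam0 : 0 <= gam.
Hypothesis gam1 : gam < 1.
Hypothesis phi_le : forall s, normv (phi s) <= 1.
Hypothesis thstarK : normv thstar <= Rad.
Hypothesis prP : is_ball_proj Rad pr.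
Hypothesis th1K : normv th1 <= Rad.
Hypothesis T0 : (0 < T)%N.

Local Notation Jw w := (fun u => J u w).
Local Notation Xw w := (fun k => X k w).
Local Notation gb := (gbar Pk mu gam Rw phi).
Local Notation G := (rmax + 2 * Rad).
Local Notation jmax := (trunc_log 2 T).

Definition iterate t w := theta gam Rw phi Rad pr th1 T (Jw w) (Xw w) t.
Definition gradient t w := gmlmc gam Rw phi T (Jw w) (Xw w) t (iterate t w).
Definition past_of t w0 : Omega -> R := hist (Ssum (Jw w0) t) t (Xw w0) (Jw w0).
(** A natural-number code of the past, so that pasts form a countable partition. The length of the
    recorded path is itself determined by the recorded draws. *)
Definition history t w : nat :=
  pickle ([seq J u w | u <- iota 0 t], [seq X i w | i <- iota 0 (Ssum (Jw w) t).+1]).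

Lemma past_of_past t w0 : (t <= T)%N ->
  past t (Ssum (Jw w0) t) (X (Ssum (Jw w0) t) w0) (past_of t w0).
Proof. by move=> tT; exists (Xw w0), (Jw w0). Qed.

Lemma historyP t w w0 : history t w = history t w0 <-> past_of t w0 w = 1.
Proof.
rewrite hist_eq1; split.
  move/(pcan_inj pickleK)/eqP; rewrite xpair_eqE => /andP [/eqP/eq_in_map hJ /eqP hX].
  have eJ u : (u < t)%N -> J u w = J u w0 by move=> ut; apply: hJ; rewrite mem_iota.
  have eS : Ssum (Jw w) t = Ssum (Jw w0) t by apply: eq_bigr => u _; rewrite eJ.
  split=> // i le; move: hX; rewrite eS => /eq_in_map; apply.
  by rewrite mem_iota.
move=> [hX hJ].
have eS : Ssum (Jw w) t = Ssum (Jw w0) t by apply: eq_bigr => u _; rewrite hJ.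
rewrite /history eS; congr (pickle (_, _)); apply/eq_in_map => i.
  by rewrite mem_iota => /andP [_ /hJ].
by rewrite mem_iota => /andP [_]; rewrite add0n ltnS => /hX.
Qed.

Lemma past_ofE t w w0 : past_of t w0 w = (history t w == history t w0)%:R.
Proof.
have [/historyP -> //|h] := eqVneq (history t w) (history t w0).
by apply: hist_neq1 => e; move/eqP: h; apply; apply/historyP.
Qed.

Lemma history_eq t w w0 : history t w = history t w0 ->
  (forall u, (u < t)%N -> J u w = J u w0) /\
  (forall i, (i <= Ssum (Jw w) t)%N -> X i w = X i w0).
Proof.
move/historyP/hist_eq1 => [hX hJ]; split => // i.
have -> : Ssum (Jw w) t = Ssum (Jw w0) t by apply: eq_bigr => u _; rewrite hJ.
exact: hX.
Qed.

Lemma measurable_history t k : measurable [set w | history t w = k].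
Proof.
have [[w0 <-]|none] := pselect (exists w0, history t w0 = k); last first.
  rewrite (_ : [set _ | _] = set0) //; apply/seteqP; split => w //= hw.
  by apply: none; exists w.
rewrite (_ : [set _ | _] = past_of t w0 @^-1` [set 1]).
  by rewrite -[X in measurable X]setTI; apply: (bmeas_hist _ _ _ _).1.
by apply/seteqP; split => w /historyP.
Qed.

Lemma bmeas_history t (f : Omega -> R) :
  (forall w w0, history t w = history t w0 -> f w = f w0) ->
  (exists K, forall w, `|f w| <= K) -> bmeas f.
Proof. exact: bmeas_countable (measurable_history t). Qed.

(** The tower property as an inequality: a bound holding on each attained history, relative to its
    probability, sums to a bound on the whole expectation. Codes attained by no sample point
    contribute zero. *)
Lemma expect_history_le t (f : Omega -> R) (c : R) : (t <= T)%N -> 0 <= c ->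
  bmeas f -> (forall w, 0 <= f w) ->
  (forall w0, E (fun w => past_of t w0 w * f w) <= c * E (past_of t w0)) -> E f <= c.
Proof.
move=> tT c0 bf f0 h; apply: (expect_partition_le P (history t)) => // [k|N].
  exact: measurable_history.
have bh k : bmeas (fun w => (history t w == k)%:R : R).
  apply: bmeas_bool; rewrite (_ : [set _ | _] = [set w | history t w = k]).
    exact: measurable_history.
  by apply/seteqP; split => w /eqP.
apply: (@le_trans _ _ (\sum_(k < N) c * E (fun w => (history t w == k)%:R))).
  apply: ler_sum => k _.
  have [[w0 <-]|none] := pselect (exists w0, history t w0 = k).
    have -> : (fun w => (history t w == history t w0)%:R : R) = past_of t w0.
      by apply/funext => w; rewrite past_ofE.
    have -> : (fun w => f w * (history t w == history t w0)%:R) = fun w => past_of t w0 w * f w.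
      by apply/funext => w; rewrite past_ofE mulrC.
    exact: h.
  have nk w : (history t w == k) = false by apply/negbTE/eqP => e; apply: none; exists w.
  rewrite (_ : (fun w => f w * _) = fun=> 0).
    by rewrite expect_cst mulr_ge0 // expect_ge0 // => w.
  by apply/funext => w; rewrite nk mulr0.
rewrite -mulr_sumr -expect_sum // -[leRHS]mulr1 ler_wpM2l //.
rewrite -[leRHS](expect_cst P); apply: expect_le => [| |w].
- exact: bmeas_sum.
- exact: bmeas_cst.
have [lt|ge] := ltnP (history t w) N.
  rewrite (bigD1 (Ordinal lt)) //= eqxx big1 ?addr0 // => i; rewrite -val_eqE /=.
  by rewrite eq_sym => /negbTE ->.
by rewrite big1 // => i _; rewrite gtn_eqF // (leq_trans (ltn_ord i)).
Qed.

Lemma iterate_history t w w0 : history t w = history t w0 -> iterate t w = iterate t w0.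
Proof.
move=> /history_eq [hJ hX]; rewrite /iterate /theta.
by rewrite (adagrad_ext _ _ _ _ _ _ _ _ _ (Jw w0) (Xw w0) _ hJ hX).
Qed.

Lemma history_prev t w w0 : history t.+1 w = history t.+1 w0 -> history t w = history t w0.
Proof.
move=> /history_eq [hJ hX]; apply/historyP/hist_eq1.
have eS : Ssum (Jw w) t = Ssum (Jw w0) t by apply: eq_bigr => u _; rewrite hJ // ltnS ltnW.
split=> [i le|u ut]; last by rewrite hJ // ltnS ltnW.
by apply: hX; rewrite (leq_trans le) // -eS /Ssum big_ord_recr leq_addr.
Qed.

Lemma history_le t u w w0 : (u <= t)%N -> history t w = history t w0 -> history u w = history u w0.
Proof.
move=> /subnK <-; elim: (t - u)%N => [//|k IH] /history_prev; exact: IH.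
Qed.

Lemma gradient_history t w w0 : history t.+1 w = history t.+1 w0 -> gradient t w = gradient t w0.
Proof.
move=> h; rewrite /gradient (iterate_history (history_prev h)).
by have [hJ hX] := history_eq h; exact: gmlmc_ext hJ hX.
Qed.

Lemma iterateK t w : normv (iterate t w) <= Rad.
Proof. exact: theta_in_ball. Qed.

Lemma G_ge0 : S -> 0 <= G.
Proof.
move=> a; have r0 := le_trans (normr_ge0 _) (Rw_le a a).
by rewrite addr_ge0 // mulr_ge0 // (le_trans (normv_ge0 _) thstarK).
Qed.

Definition centered (th : 'rV[R]_d) (a b : S) : 'rV[R]_d := gsemi gam Rw phi th a b - gb th.

Lemma centered_le th a b : normv th <= Rad -> normv (centered th a b) <= 2 * G.
Proof.
move=> thK; rewrite (le_trans (normvB _ _)) // mulr_natl mulr2n lerD //.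
  exact: normv_gsemi_le.
exact: normv_gbar_le.
Qed.

Lemma centered_mean0 th : \sum_a mu a *: \sum_b Pk a b *: centered th a b = 0.
Proof.
under eq_bigr => a _.
  under eq_bigr do rewrite scalerBr.
  rewrite sumrB -scaler_suml stoch.2 scale1r scalerBr.
  over.
by rewrite sumrB -scaler_suml stat.1.2 scale1r subrr.
Qed.

Lemma gj_centered j t th w : gj gam Rw phi (Jw w) (Xw w) t j th =
  gb th + avg (centered th) j (Ssum (Jw w) t) w.
Proof.
rewrite /avg /block /centered sumrB sumr_const card_ord scalerBr.
rewrite -(scaler_nat _ (gb th)) scalerA natrX mulVf ?expf_neq0 // scale1r addrCA subrr addr0.
by [].
Qed.

Lemma gmlmc_centered t th w : gmlmc gam Rw phi T (Jw w) (Xw w) t th = gb th +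
  (avg (centered th) 0 (Ssum (Jw w) t) w +
   correction (centered th) t (Ssum (Jw w) t) jmax w).
Proof.
have none : (forall j : 'I_jmax, J t w != j.+1) ->
    correction (centered th) t (Ssum (Jw w) t) jmax w = 0.
  by move=> h; apply: big1 => j _; rewrite (negbTE (h j)) mul0r scale0r.
rewrite /gmlmc !gj_centered; case: ifP => le; last first.
  rewrite none ?addr0 // => j; apply: contraFneq le => ->.
  apply: leq_trans (trunc_logP (isT : 1 < 2)%N T0).
  by rewrite leq_exp2l.
(* A zero draw has probability zero but is possible pointwise; as [0.-1 = 0], its two averages
   coincide and the correction vanishes. *)
case e: (J t w) => [|j].
  by rewrite subrr scaler0 none ?addr0 // => j; rewrite e.
have jm : (j < jmax)%N by rewrite -e; exact: trunc_log_max.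
rewrite addrA /correction (bigD1 (Ordinal jm)) //= big1 ?addr0 => [|i ij].
  by rewrite e eqxx mul1r opprD addrACA subrr add0r.
rewrite e eqSS (_ : (j == i) = false) ?mul0r ?scale0r //.
by apply/negbTE; rewrite eq_sym; exact: ij.
Qed.

Lemma normv_gj_le t j th w : normv th <= Rad ->
  normv (gj gam Rw phi (Jw w) (Xw w) t j th) <= G.
Proof.
move=> thK; rewrite normvZ ger0_norm ?invr_ge0 ?exprn_ge0 //.
rewrite mulrC ler_pdivrMr ?exprn_gt0 // (le_trans (normv_sum _ _ _ _)) //.
rewrite -natrX mulr_natr -[X in _ *+ X]card_ord -sumr_const.
by apply: ler_sum => i _; exact: normv_gsemi_le.
Qed.

(** A crude pathwise bound, from the cutoff [2 ^ J t <= T]. It supplies boundedness of integrands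
    and the shift [excess_range]; the rate comes from conditional moments. *)
Lemma normv_gradient_le t w : normv (gradient t w) <= G + T%:R * (2 * G).
Proof.
have GG := G_ge0 (X 0%N w).
rewrite /gradient /gmlmc; case: ifP => le; last first.
  rewrite (le_trans (normv_gj_le _ _ _ (iterateK _ _))) // lerDl !mulr_ge0 //.
rewrite (le_trans (normvD _ _)) // lerD //; first exact: normv_gj_le (iterateK _ _).
rewrite normvZ ger0_norm ?exprn_ge0 // ler_pM ?exprn_ge0 ?normv_ge0 //.
  by rewrite -natrX ler_nat.
rewrite (le_trans (normvB _ _)) // mulr_natl mulr2n lerD //; exact: normv_gj_le (iterateK _ _).
Qed.

Variable alpha : R.
Hypothesis alpha0 : 0 <= alpha.

(** The loss charged to one iteration: its share of the linearised regret, plus the error made by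
    using the estimator in place of the mean gradient. *)
Definition excess t w : R := alpha * normv (gradient t w) ^+ 2 +
  dotv (gradient t w - gb (iterate t w)) (iterate t w - thstar).

(** The estimator splits into a plain sample gradient of norm at most [G], giving [2 G^2], and the
    correction, giving [2 * 30 * (2 G)^2 = 240 G^2] per level and unit of [tau]. The last term is
    the bias [2 * (2 G) * tau / 2 ^ jmax] times the diameter [2 Rad]. *)
Definition excess_bound : R :=
  alpha * (2 * G ^+ 2 + 240 * jmax%:R * G ^+ 2 * tau%:R) + 8 * Rad * G * tau%:R / 2 ^+ jmax.

Definition excess_range : R :=
  alpha * (G + T%:R * (2 * G)) ^+ 2 + (G + T%:R * (2 * G) + G) * (2 * Rad).

Lemma excess_dot_le t w :
  `|dotv (gradient t w - gb (iterate t w)) (iterate t w - thstar)| <=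
  (G + T%:R * (2 * G) + G) * (2 * Rad).
Proof.
rewrite (le_trans (normr_dotv_le _ _)) // ler_pM ?normv_ge0 //.
  rewrite (le_trans (normvB _ _)) // lerD ?normv_gradient_le //.
  exact: normv_gbar_le (iterateK _ _).
rewrite (le_trans (normvB _ _)) // mulr_natl mulr2n lerD // iterateK //.
Qed.

Lemma excess_range_le t w : `|excess t w| <= excess_range.
Proof.
rewrite (le_trans (ler_normD _ _)) // lerD // ?excess_dot_le //.
rewrite ger0_norm ?mulr_ge0 ?exprn_ge0 ?normv_ge0 // ler_wpM2l //.
have h := normv_gradient_le t w.
by rewrite ler_pXn2r ?nnegrE ?normv_ge0 // (le_trans (normv_ge0 _) h).
Qed.

Lemma bmeas_excess t : bmeas (excess t).
Proof.
apply: (@bmeas_history t.+1) => [w w0 h|]; last by exists excess_range; exact: excess_range_le.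
by rewrite /excess (gradient_history h) (iterate_history (history_prev h)).
Qed.

(** On the support of [past_of t w0] the iterate equals the constant [th] and the block starts at
    the constant index [n], so the block estimates apply to the fixed function [centered th] with
    [B = 2 G]. *)
Lemma past_expect_excess t w0 : (t < T)%N ->
  E (fun w => past_of t w0 w * excess t w) <= excess_bound * E (past_of t w0).
Proof.
move=> tT; have h := past_of_past w0 (ltnW tT).
have thK := iterateK t w0; set th := iterate t w0 in thK.
set n := Ssum (Jw w0) t in h; set x := X n w0 in h; set chi := past_of t w0 in h *.
have GG := G_ge0 x; have bchi := past_bmeas h; have chi0 := past_expect_ge0 h.
pose C w := correction (centered th) t n jmax w.
pose A w := avg (centered th) 0 n w.
have bC : bmeas (fun w => chi w * normv (C w) ^+ 2).
  by apply: bmeasM => //; apply: bmeas_normv_sqr => k; exact: bmeas_correction.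
have bD : bmeas (fun w => chi w * dotv (A w + C w) (th - thstar)).
  rewrite (_ : (fun w => _) = fun w => chi w * (dotv (gradient t w - gb (iterate t w)) (iterate t w - thstar))).
    apply: bmeasM => //; apply: (@bmeas_history t.+1) => [w w1 e|].
      by rewrite (gradient_history e) (iterate_history (history_prev e)).
    by eexists => w; exact: excess_dot_le.
  apply/funext => w; rewrite /chi past_ofE; case: eqP => [e|_]; last by rewrite !mul0r.
  have eS : Ssum (Jw w) t = n.
    by apply: eq_bigr => u _; case: (history_eq e) => -> //.
  by rewrite /gradient (iterate_history e) gmlmc_centered eS -/th addrAC subrr add0r.
apply: (@le_trans _ _ (E (fun w => (alpha * (2 * G ^+ 2) * chi w +
    alpha * 2 * (chi w * normv (C w) ^+ 2)) + chi w * dotv (A w + C w) (th - thstar)))).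
  apply: expect_le => [| |w].
  - by apply: bmeasM; [exact: bchi|exact: bmeas_excess].
  - by apply: bmeasD => //; apply: bmeasD; exact: bmeasZ.
  rewrite /chi past_ofE; case: eqP => [e|_]; last by rewrite !(mul0r, mulr0) !addr0.
  have eS : Ssum (Jw w) t = n.
    by apply: eq_bigr => u _; case: (history_eq e) => -> //.
  rewrite /excess /gradient (iterate_history e) -/th !mul1r mulr1.
  rewrite lerD //; last first.
    by rewrite gmlmc_centered eS addrAC subrr add0r.
  rewrite -mulrA -mulrDr ler_wpM2l // gmlmc_centered eS addrA.
  apply: le_trans (normv_sqrD_le _ _) _; rewrite lerD // ler_wpM2l //.
  rewrite ler_pXn2r ?nnegrE ?normv_ge0 // /A -eS -gj_centered.
  exact: normv_gj_le.
rewrite expectD //; last by apply: bmeasD; exact: bmeasZ.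
rewrite expectD ?expectZ //; [|exact: bmeasZ|exact: bmeasZ].
have FB a b : normv (centered th a b) <= 2 * G by exact: centered_le.
have i1 := past_expect_correction_sqr (centered th) (2 * G) stat mix FB (centered_mean0 th) jmax h tT.
have i2 := past_expect_mlmc (centered th) jmax (th - thstar) h tT.
rewrite i2.
have i3 : dotv (mean_avg (centered th) jmax x) (th - thstar) <= 8 * Rad * G * tau%:R / 2 ^+ jmax.
  apply: le_trans (dotv_le _ _) _.
  have -> : 8 * Rad * G * tau%:R / 2 ^+ jmax = (2 * (2 * G) * tau%:R / 2 ^+ jmax) * (2 * Rad).
    by rewrite -!mulrA; ring.
  apply: ler_pM; rewrite ?normv_ge0 //.
    exact: (normv_mean_avg_le (centered th) _ stat mix FB (centered_mean0 th)).
  by rewrite (le_trans (normvB _ _)) // mulr_natl mulr2n lerD.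
rewrite /excess_bound [leRHS]mulrDl; apply: lerD; last exact: ler_wpM2r.
have := ler_wpM2l (mulr_ge0 alpha0 (ler0n R 2)) i1.
lra.
Qed.

(* Shifting by [excess_range] makes the integrand nonnegative. *)
Lemma expect_excess t : S -> (t < T)%N -> E (excess t) <= excess_bound.
Proof.
move=> a tT; have GG := G_ge0 a.
have Rad0 : 0 <= Rad by apply: le_trans thstarK; exact: normv_ge0.
have K0 : 0 <= excess_range.
  have TG : 0 <= G + T%:R * (2 * G) by rewrite addr_ge0 // mulr_ge0 // mulr_ge0.
  apply: addr_ge0; first exact: mulr_ge0 alpha0 (exprn_ge0 _ TG).
  by apply: mulr_ge0; [exact: addr_ge0|rewrite mulr_ge0].
have B0 : 0 <= excess_bound.
  apply: addr_ge0; last by rewrite divr_ge0 ?exprn_ge0 // !mulr_ge0.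
  apply: (mulr_ge0 alpha0); apply: addr_ge0; first by rewrite mulr_ge0 ?exprn_ge0.
  exact: mulr_ge0 (mulr_ge0 (mulr_ge0 (ler0n _ _) (ler0n _ _)) (exprn_ge0 _ GG)) (ler0n _ _).
have be := bmeas_excess t; have bK := bmeas_cst excess_range.
rewrite -(lerD2r excess_range) -[X in _ + X <= _](expect_cst P) -expectD //.
apply: (expect_history_le (ltnW tT)) => [|||w0].
- exact: addr_ge0.
- exact: bmeasD.
- by move=> w; have := excess_range_le t w; rewrite ler_norml => /andP[]; lra.
have h := past_of_past w0 (ltnW tT); have bchi := past_bmeas h.
rewrite (_ : (fun w => _) = fun w => past_of t w0 w * excess t w + excess_range * past_of t w0 w).
  have b1 : bmeas (fun w => past_of t w0 w * excess t w) by exact: bmeasM.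
  have b2 : bmeas (fun w => excess_range * past_of t w0 w) by exact: bmeasZ.
  by rewrite expectD // expectZ // [leRHS]mulrDl lerD2r past_expect_excess.
by apply/funext => w; rewrite mulrDr (mulrC _ excess_range).
Qed.

Definition error w : R := Mnorm2 mu (fun s => Vf phi thstar s -
  Vf phi (thetabar gam Rw phi Rad pr th1 T (Jw w) (Xw w)) s).

Lemma error_le w : error w <= (2 * Rad) ^+ 2.
Proof.
apply: le_trans (Mnorm2_mean_le _ _ phi stat (fun t => iterate t w) thstar _ T0) _.
rewrite mulrC ler_pdivrMr ?ltr0n // mulr_natr -[X in _ *+ X]card_ord -sumr_const.
by apply: ler_sum => t _; apply: Mnorm2_le stat phi_le _ _ thstarK (iterateK _ _).
Qed.

Lemma error_ge0 w : 0 <= error w.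
Proof. by apply: sumr_ge0 => s _; rewrite mulr_ge0 ?sqr_ge0 ?stat.1.1. Qed.

Lemma bmeas_error : bmeas error.
Proof.
apply: (@bmeas_history T) => [w w0 h|]; last first.
  by exists ((2 * Rad) ^+ 2) => w; rewrite ger0_norm ?error_ge0 ?error_le.
rewrite /error; have -> // : thetabar gam Rw phi Rad pr th1 T (Jw w) (Xw w) =
  thetabar gam Rw phi Rad pr th1 T (Jw w0) (Xw w0).
rewrite /thetabar; congr (_ *: _); apply: eq_bigr => t _.
exact: iterate_history (history_le (ltnW (ltn_ord t)) h).
Qed.

Hypothesis thstar0 : gb thstar = 0.
Hypothesis Rad0 : 0 < Rad.
Variable c : R.

Hypothesis alphaE : alpha * c = Num.sqrt 2 * Rad.

(* The regret of AdaGrad involves [sqrt (sum |g_t|^2)], linearised here by AM-GM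
   around the level [c]. *)
Lemma error_le_excess w :
  (1 - gam) * T%:R * error w <= Num.sqrt 2 * Rad * c + \sum_(t < T) excess t w.
Proof.
have T0' : 0 < T%:R :> R by rewrite ltr0n.
have h1 : T%:R * error w <=
    \sum_(t < T) Mnorm2 mu (fun s => Vf phi thstar s - Vf phi (iterate t w) s).
  rewrite mulrC -ler_pdivlMr // mulrC.
  exact: (Mnorm2_mean_le _ _ phi stat (fun t => iterate t w) thstar _ T0).
have g0 : 0 <= 1 - gam by rewrite subr_ge0 ltW.
rewrite -mulrA; apply: le_trans (ler_wpM2l g0 h1) _; rewrite mulr_sumr.
apply: (@le_trans _ _ (\sum_(t < T) dotv (gb (iterate t w)) (thstar - iterate t w))).
  by apply: ler_sum => t _; apply: gbar_dot_ge.
have -> : \sum_(t < T) excess t w = alpha * (\sum_(t < T) normv (gradient t w) ^+ 2) -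
    \sum_(t < T) dotv (gradient t w) (thstar - iterate t w) +
    \sum_(t < T) dotv (gb (iterate t w)) (thstar - iterate t w).
  rewrite mulr_sumr -sumrB -big_split; apply: eq_bigr => t _ /=.
  by rewrite /excess dotvBl -[iterate t w - _]opprB !dotvNr; ring.
have := adagrad_regret gam Rw phi Rad pr th1 T (Jw w) (Xw w) prP th1K thstar T Rad0 thstarK.
rewrite -/(gradient _ w) -/(iterate _ w).
set Q := \sum_(t < T) normv (gradient t w) ^+ 2.
have Q0 : 0 <= Q by apply: sumr_ge0 => t _; exact: sqr_ge0.
have am : 2 * (Num.sqrt 2 * Rad) * Num.sqrt Q <= alpha * Q + Num.sqrt 2 * Rad * c.
  rewrite -alphaE -[in leRHS](sqr_sqrtr Q0).
  have : 0 <= alpha * (Num.sqrt Q - c) ^+ 2 by rewrite mulr_ge0 ?sqr_ge0.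
  lra.
rewrite -/Q; lra.
Qed.

Lemma expect_error_le : S ->
  E error <= (Num.sqrt 2 * Rad * c + T%:R * excess_bound) / ((1 - gam) * T%:R).
Proof.
move=> a; have T0' : 0 < T%:R :> R by rewrite ltr0n.
rewrite ler_pdivlMr ?mulr_gt0 ?subr_gt0 // mulrC -expectZ; last exact: bmeas_error.
apply: (@le_trans _ _ (E (fun w => Num.sqrt 2 * Rad * c + \sum_(t < T) excess t w))).
  apply: expect_le; last exact: error_le_excess.
  - by apply: bmeasZ; exact: bmeas_error.
  - by apply: bmeasD; [exact: bmeas_cst|apply: bmeas_sum => t; exact: bmeas_excess].
rewrite expectD; [|exact: bmeas_cst|by apply: bmeas_sum => t; exact: bmeas_excess].
rewrite expect_cst lerD2l expect_sum; last by move=> t; exact: bmeas_excess.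
rewrite mulr_natl -[X in _ *+ X]card_ord -sumr_const; apply: ler_sum => t _.
exact: expect_excess.
Qed.

End History.

End ChainAndDraws.

(** * Rate *)

Lemma trunc_log_le_ln {R : realType} (T : nat) : (0 < T)%N ->
  (trunc_log 2 T)%:R <= 2 * ln (T%:R : R).
Proof.
(* From [ln (1 + x) <= x] at [x = -1/2]; this is the origin of the factor 2. *)
move=> T0; have half : 2^-1 <= ln (2 : R).
  have : ln (1 + (- 2^-1 : R)) <= - 2^-1 by apply: le_ln1Dx; lra.
  rewrite (_ : 1 + (- 2^-1 : R) = 2^-1); last by field.
  by rewrite lnV ?posrE // lerN2.
have : ln ((2 : R) ^+ trunc_log 2 T) <= ln (T%:R : R).
  rewrite ler_ln ?posrE ?exprn_gt0 ?ltr0n // -natrX ler_nat.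
  exact: trunc_logP.
rewrite lnXn // -(mulr_natr (ln 2)) => h.
have := ler_wpM2r (ler0n R (trunc_log 2 T)) half; lra.
Qed.

(* Here [q = sqrt 2], [s = sqrt tau], [r = sqrt T], [l = ln T], [p = 2 ^ jm], and
   the AM-GM level is [G * s * r]. *)
Lemma rate_bound {R : realType} (q Rad G s r l jm p : R) :
  0 <= q -> q <= 2 -> 0 < Rad -> 0 < G -> 1 <= s -> s <= r -> 0 <= jm -> jm <= 2 * l ->
  r ^+ 2 <= 2 * p ->
  q * Rad * (G * s * r) + r ^+ 2 * (q * Rad / (G * s * r) *
    (2 * G ^+ 2 + 240 * jm * G ^+ 2 * s ^+ 2) + 8 * Rad * G * s ^+ 2 / p) <=
  1000 * (1 + l) * (G * Rad * s) * r.
Proof.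
move=> q0 q2 Rad0 G0 s1 sr jm0 jml rp.
have s0 : 0 < s by lra.
have r0 : 0 < r by lra.
have p0 : 0 < p by have := exprn_gt0 2 r0; lra.
set K := Rad * G * s * r; have K0 : 0 < K by rewrite !mulr_gt0.
have last_le : r ^+ 2 * (8 * Rad * G * s ^+ 2 / p) <= 16 * K.
  have -> : r ^+ 2 * (8 * Rad * G * s ^+ 2 / p) = 8 * Rad * G * s ^+ 2 * (r ^+ 2 / p).
    by field; rewrite gt_eqF.
  have h : r ^+ 2 / p <= 2 by rewrite ler_pdivrMr.
  have h0 : 0 <= 8 * Rad * G * s ^+ 2 by rewrite !mulr_ge0 ?exprn_ge0 ?ltW.
  apply: le_trans (ler_wpM2l h0 h) _.
  have -> : 16 * K = 8 * Rad * G * (s * r) * 2 by rewrite /K; ring.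
  rewrite ler_pM2r // ler_wpM2l ?mulr_ge0 ?(ltW Rad0) ?(ltW G0) //.
  by rewrite expr2 ler_pM2l.
(* The level [G * s * r] is the balancing choice: its coefficient times [r^2 G^2 s^2] is [q * K],
   the size of the leading term, leaving only the number of levels [jm] as an extra factor. *)
have mid_le : r ^+ 2 * (q * Rad / (G * s * r) * (2 * G ^+ 2 + 240 * jm * G ^+ 2 * s ^+ 2))
    <= q * K * (2 + 240 * jm).
  have -> : r ^+ 2 * (q * Rad / (G * s * r) * (2 * G ^+ 2 + 240 * jm * G ^+ 2 * s ^+ 2)) =
     q * (Rad * G * r * (2 / s + 240 * jm * s)) by field; rewrite !gt_eqF.
  rewrite -[leRHS]mulrA; apply: (ler_wpM2l q0).
  have -> : K * (2 + 240 * jm) = Rad * G * r * (2 * s + 240 * jm * s) by rewrite /K; ring.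
  apply: ler_wpM2l; first by rewrite !mulr_ge0 ?ltW.
  rewrite lerD2r; apply: ler_wpM2l => //.
  by apply: (le_trans _ s1); rewrite invf_le1.
have top_le : q * K * (3 + 240 * jm) <= 2 * K * (3 + 240 * (2 * l)).
  have q2K : q * K <= 2 * K by rewrite ler_pM2r.
  apply: ler_pM q2K _ => //; [exact: mulr_ge0 q0 (ltW K0)|lra|lra].
have Kl : 0 <= K * l by rewrite mulr_ge0 ?(ltW K0) //; lra.
have -> : 1000 * (1 + l) * (G * Rad * s) * r = 1000 * K + 1000 * (K * l) by rewrite /K; ring.
have -> : q * Rad * (G * s * r) = q * K by rewrite /K; ring.
rewrite mulrDr; lra.
Qed.
Theorem theorem5p2 :
  exists c k : nat,
  forall (R : realType) (S : finType) (d : nat)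
    (Pk : S -> S -> R) (mu : S -> R) (Rw : S -> S -> R) (rmax gam : R)
    (phi : S -> 'rV[R]_d) (Rad : R) (thstar th1 : 'rV[R]_d)
    (pr : 'rV[R]_d -> 'rV[R]_d) (T tau : nat)
    (dm : measure_display) (Omega : measurableType dm) (P : probability Omega R)
    (X : nat -> Omega -> S) (J : nat -> Omega -> nat),
  stochastic Pk -> ergodic Pk -> stationary Pk mu ->
  is_mixing_time Pk mu tau ->
  (forall a b, `|Rw a b| <= rmax) ->
  0 <= gam -> gam < 1 ->
  (forall s, normv (phi s) <= 1) ->
  0 < Rad ->
  gbar Pk mu gam Rw phi thstar = 0 -> normv thstar <= Rad ->
  is_ball_proj Rad pr ->
  normv th1 <= Rad ->
  (0 < T)%N ->
  (* the random state trajectory X k = s_{k+1} and draws J t = J_{t+1} *)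
  (forall k a, measurable [set w | X k w = a]) ->
  (forall t j, measurable [set w | J t w = j]) ->
  (forall (n : nat) (a : nat -> S) (js : nat -> nat),
     P [set w | (forall i, (i <= n)%N -> X i w = a i) /\
                (forall t, (t < T)%N -> J t w = js t)]
     = (P [set w | X 0%N w = a 0%N] *
        ((\prod_(i < n) Pk (a i) (a i.+1)) * \prod_(t < T) geom2 R (js t))%:E)%E) ->
  (\int[P]_w
     (Mnorm2 mu (fun s =>
        Vf phi thstar s -
        Vf phi (thetabar gam Rw phi Rad pr th1 T (fun t => J t w) (fun k => X k w)) s))%:E
   <= (c%:R * (1 + ln (T%:R) + ln (tau%:R)) ^+ k *
       ((rmax + 2 * Rad) * Rad * Num.sqrt (tau%:R)) /
       ((1 - gam) * Num.sqrt (T%:R)))%:E)%E.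
Proof.
(* One logarithmic factor suffices, coming from the number of levels. The terms collected in
   [rate_bound] amount to [22 + 960 * ln T], with [22 = 2 * 3 + 16] and [960 = 2 * 240 * 2]. *)
exists 1000%N, 1%N => R S d Pk mu Rw rmax gam phi Rad thstar th1 pr T tau dm Omega P X J.
move=> stoch _ stat mix Rw_le gam0 gam1 phi_le Rad0 thstar0 thstarK prP th1K T0 mX mJ law.
(* [S] is inhabited because [mu] has total mass 1; a state is needed to deduce [rmax >= 0] from the
   reward bound. *)
have [a _] : exists a : S, true.
  case: (pickP (fun _ : S => true)) => [a _|none]; first by exists a.
  by have := stat.1.2; rewrite big_pred0 // => /eqP; rewrite eq_sym oner_eq0.
set G := rmax + 2 * Rad.
have rmax0 : 0 <= rmax := le_trans (normr_ge0 _) (Rw_le a a).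
have G0 : 0 < G by rewrite /G; lra.
have tau0 : (0 < tau)%N by case: mix.
have bE := bmeas_error mX mJ gam Rw stat phi_le thstarK prP th1K T0.
set e := error T X J mu gam Rw phi Rad pr th1 thstar in bE.
have -> : (\int[P]_w (Mnorm2 mu (fun s => Vf phi thstar s - Vf phi (thetabar gam Rw phi Rad pr th1
    T (fun t => J t w) (fun k => X k w)) s))%:E = (expect P e)%:E)%E.
  by rewrite /expect /Rintegral fineK //; exact: integrable_fin_num (bmeas_integrable P e bE).
rewrite lee_fin expr1.
set l := ln T%:R; set s := Num.sqrt tau%:R; set r := Num.sqrt T%:R.
have T1 : 1 <= T%:R :> R by rewrite ler1n.
have l0 : 0 <= l by exact: ln_ge0.
have lt0 : 0 <= ln tau%:R :> R by rewrite ln_ge0 // ler1n.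
have sqrt1 (n : nat) : (0 < n)%N -> 1 <= Num.sqrt n%:R :> R.
  by move=> n0; rewrite -[X in X <= _]sqrtr1 ler_sqrt ?ler1n ?ltr0n.
have s1 : 1 <= s by exact: sqrt1.
have r1 : 1 <= r by exact: sqrt1.
have s0 : 0 < s by lra.
have r0 : 0 < r by lra.
have r2 : r ^+ 2 = T%:R by rewrite sqr_sqrtr.
have s2 : s ^+ 2 = tau%:R by rewrite sqr_sqrtr.
have g0 : 0 < 1 - gam by rewrite subr_gt0.
have den0 : 0 < (1 - gam) * r by rewrite mulr_gt0.
have weaken : 1000 * (1 + l) * (G * Rad * s) <= 1000 * (1 + l + ln tau%:R) * (G * Rad * s).
  by apply: ler_wpM2r; [rewrite !mulr_ge0 ?ltW|lra].
(* The rate computation trades [s^2] for [s * r] in the bias term, which requires [s <= r].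
   Otherwise [(1 - gam) * r <= s], and the diameter bound [(2 * Rad)^2 <= 2 * Rad * G] is enough. *)
have [tauT|Ttau] := leqP tau T; last first.
  have rs : r <= s by rewrite ler_sqrt // ler_nat ltnW.
  have bound : expect P e <= (2 * Rad) ^+ 2.
    rewrite -[leRHS](expect_cst P); apply: expect_le => //; first exact: bmeas_cst.
    by move=> w; exact: (error_le X J gam Rw stat phi_le thstarK prP th1K T0 w).
  apply: le_trans bound _; rewrite ler_pdivlMr //; apply: le_trans weaken.
  have h1 : (2 * Rad) ^+ 2 <= 2 * (Rad * G).
    by have := mulr_ge0 (ltW Rad0) rmax0; rewrite expr2 /G; lra.
  have h2 : (1 - gam) * r <= s.
    by apply: (le_trans _ rs); apply: ler_piMl; [exact: ltW|lra].
  apply: le_trans (ler_pM (exprn_ge0 2 _) (ltW den0) h1 h2) _; first by rewrite mulr_ge0 // ltW.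
  have K0 : 0 <= Rad * G * s by rewrite !mulr_ge0 ?ltW.
  have Kl : 0 <= l * (Rad * G * s) by exact: mulr_ge0.
  have -> : 1000 * (1 + l) * (G * Rad * s) = 1000 * (Rad * G * s) + 1000 * (l * (Rad * G * s)).
    by ring.
  lra.
have sr : s <= r by rewrite ler_sqrt ?ler_nat.
pose q : R := Num.sqrt 2.
have q2 : q <= 2.
  by rewrite -(ler_pXn2r (n := 2)) ?nnegrE ?sqrtr_ge0 // sqr_sqrtr //; lra.
have alpha0 : 0 <= q * Rad / (G * s * r) by rewrite divr_ge0 ?mulr_ge0 ?sqrtr_ge0 ?ltW.
have alphaE : q * Rad / (G * s * r) * (G * s * r) = Num.sqrt 2 * Rad.
  by rewrite mulfVK // !mulf_neq0 ?gt_eqF.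
apply: le_trans (expect_error_le stoch mX mJ law stat mix Rw_le gam0 gam1 phi_le thstarK prP
  th1K T0 alpha0 thstar0 Rad0 alphaE a) _.
have p2 : r ^+ 2 <= 2 * (2 ^+ trunc_log 2 T).
  by rewrite r2 -exprS -natrX ler_nat ltnW // trunc_log_ltn.
have := rate_bound (sqrtr_ge0 _) q2 Rad0 G0 s1 sr (ler0n _ _) (trunc_log_le_ln T0) p2.
rewrite -/l => h; rewrite /excess_bound -/G -s2 -r2.
rewrite ler_pdivrMr ?mulr_gt0 ?exprn_gt0 //.
apply: le_trans h _.
apply: le_trans (ler_wpM2r (ltW r0) weaken) _.
rewrite s2 le_eqVlt; apply/orP; left; apply/eqP; field.
by rewrite !gt_eqF.
Qed.
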